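(* There exist a compact Hausdorff space $X$, a separable, essential uniform algebra $A$ on $X$ (so that $X$ is the character space of $A$), and a continuous derivation $D: A\to A'$ such that $D$ does not annihilate $A_{lc}$, i.e. there is $f\in A_{lc}$ with $D(f)\neq 0$.
   Context: Conventions: $C(X)$ is the algebra of all continuous complex-valued functions on a compact Hausdorff space $X$, with uniform norm. A uniform algebra $A$ on $X$ is a uniformly closed subalgebra of $C(X)$ which contains the constants and separates the points of $X$, and such that $X$ is the character space of $A$, i.e. every character of $A$ (nonzero multiplicative linear functional $A\to\mathbb{C}$) is evaluation at some point of $X$. Separable means separable in the uniform norm. Essential: the essential set of $A$ is the smallest closed subset $E$ of $X$ such that every $f\in C(X)$ vanishing on $E$ belongs to $A$; $A$ is essential if its essential set is all of $X$. The Banach space dual $A'$ is a Banach $A$-bimodule with $(a\cdot\phi)(b)=\phi(ba)$ and $(\phi\cdot a)(b)=\phi(ab)$ for $a,b\in A$, $\phi\in A'$. A derivation $D:A\to A'$ is a linear map with $D(ab)=D(a)\cdot b+a\cdot D(b)$ for all $a,b\in A$. $A_{lc} := \{f\in A : \text{there exists a dense open set } U\subseteq X \text{ with } f \text{ locally constant on } U\}$ (the set $U$ may depend on $f$). *)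

(* Defs.v *)
From HB Require Import structures.
From mathcomp Require Import all_boot all_order all_algebra.
From mathcomp Require Import complex.
From mathcomp Require Import all_classical all_reals all_analysis.

Set Implicit Arguments.
Unset Strict Implicit.
Unset Printing Implicit Defensive.

Import Order.TTheory GRing.Theory Num.Theory.
Import numFieldNormedType.Exports.

Local Open Scope classical_set_scope.
Local Open Scope ring_scope.

(* R[i], declared as a numClosedFieldType so that it inherits the norm and the
   topology that MathComp-Analysis attaches to numeric fields. *)
Definition Cx (R : realType) : numClosedFieldType := R[i]%C.

Definition Cabs {R : realType} (z : Cx R) : R := complex.Re (`|z| : R[i]).

Definition Creal {R : realType} (r : R) : Cx R := (r%:C)%C.

(* The norm of a normed space over Cx R takes its values in Cx R, so the
   supremum is computed in R and then injected into Cx R. *)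
Definition sup_abs {R : realType} {T : Type} (S : set T) (g : T -> Cx R) : Cx R :=
  Creal (sup [set Cabs (g t) | t in S]).

Definition abs_bounded {R : realType} {T : Type} (S : set T) (g : T -> Cx R) :=
  exists M : Cx R, forall t, S t -> `|g t| <= M.

Section SupAbs.
Context {R : realType}.
Implicit Types (z w : Cx R) (r s : R).

Lemma CabsE z : `|z| = Creal (Cabs z).
Proof. by rewrite /Cabs /Creal normc_def. Qed.

Lemma ler_Creal r s : (Creal r <= Creal s) = (r <= s).
Proof. by rewrite /Creal lecR. Qed.

Lemma ltr_Creal r s : (Creal r < Creal s) = (r < s).
Proof. by rewrite /Creal ltcR. Qed.

Lemma Creal_norm r : `|Creal r| = Creal `|r|.
Proof. by rewrite /Creal normc_def/= expr0n addr0 sqrtr_sqr. Qed.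

Lemma Creal0 : Creal (0 : R) = 0.
Proof. by []. Qed.

Lemma ge0_Creal z : 0 <= z -> exists2 r, 0 <= r & z = Creal r.
Proof.
move=> z0; exists (Cabs z); last by rewrite -CabsE ger0_norm.
by rewrite -ler_Creal -CabsE Creal0 normr_ge0.
Qed.

Context {T : Type}.
Implicit Types (S : set T) (g : T -> Cx R).

Lemma sup_abs_ge0 S g : 0 <= sup_abs S g.
Proof.
rewrite -Creal0 ler_Creal; case: (pselect (has_sup [set Cabs (g t) | t in S])).
  move=> [[r Sr] ub]; case: (Sr) => t St rE.
  apply: (le_trans _ (ub_le_sup ub Sr)).
  by rewrite -rE -ler_Creal -CabsE Creal0.
by move=> /sup_out ->.
Qed.

Lemma abs_le_sup_abs S g t : abs_bounded S g -> S t -> `|g t| <= sup_abs S g.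
Proof.
move=> [M gM] St; rewrite CabsE ler_Creal.
have [r _ ME] : exists2 r, 0 <= r & M = Creal r.
  by apply: ge0_Creal; apply: le_trans (gM _ St).
apply: ub_le_sup; last by exists t.
exists r => _ [u Su <-].
by rewrite -ler_Creal -CabsE -ME gM.
Qed.

Lemma sup_abs_le S g (M : Cx R) : 0 <= M ->
  (forall t, S t -> `|g t| <= M) -> sup_abs S g <= M.
Proof.
move=> M0 gM; have [r r0 ME] := ge0_Creal M0; rewrite ME ler_Creal.
case: (pselect ([set Cabs (g t) | t in S] !=set0)) => [ne|/set0P/negP].
  apply: ge_sup => // _ [t St <-].
  by rewrite -ler_Creal -CabsE -ME gM.
by rewrite negbK => /eqP ->; rewrite sup0.
Qed.

Lemma sup_absD S g h : abs_bounded S g -> abs_bounded S h ->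
  sup_abs S (fun t => g t + h t) <= sup_abs S g + sup_abs S h.
Proof.
move=> gb hb; apply: sup_abs_le => [|t St]; first by rewrite addr_ge0 ?sup_abs_ge0.
by apply: le_trans (ler_normD _ _) _; rewrite lerD ?abs_le_sup_abs.
Qed.

Lemma sup_absZ S g (k : Cx R) : abs_bounded S g ->
  sup_abs S (fun t => k * g t) = `|k| * sup_abs S g.
Proof.
move=> gb; apply/eqP; rewrite eq_le; apply/andP; split.
  apply: sup_abs_le => [|t St]; first by rewrite mulr_ge0 ?sup_abs_ge0.
  by rewrite normrM ler_wpM2l ?abs_le_sup_abs.
have [->|k0] := eqVneq k 0; first by rewrite normr0 mul0r sup_abs_ge0.
have kgb : abs_bounded S (fun t => k * g t).
  case: gb => M gM; exists (`|k| * M) => t St.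
  by rewrite normrM ler_wpM2l ?gM.
rewrite -ler_pdivlMl ?normr_gt0//; apply: sup_abs_le => [|t St].
  by rewrite mulr_ge0 ?sup_abs_ge0// invr_ge0.
rewrite ler_pdivlMl ?normr_gt0// -normrM.
exact: (@abs_le_sup_abs S (fun t => k * g t) t kgb St).
Qed.

End SupAbs.

HB.mixin Record isCompactHausdorff (X : Type) & Topological X := {
  compact_setT : compact [set: X];
  hausdorff_setT : hausdorff_space X
}.

#[short(type="compactHausdorffType")]
HB.structure Definition CompactHausdorff :=
  {X of Topological X & isCompactHausdorff X}.

(* C(X) is a fresh type, because the library's continuousType already carries a
   topology other than the one of the uniform norm. *)
Section ContinuousFunctions.
Variables (R : realType) (X : compactHausdorffType).

Definition continuous_pred : {pred X -> Cx R} :=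
  fun f => `[< continuous f >].

Record cfun := CFun {
  cfun_val :> X -> Cx R;
  cfunP : cfun_val \in continuous_pred
}.

HB.instance Definition _ := [isSub for cfun_val].
HB.instance Definition _ := [Choice of cfun by <:].

Lemma cfun_continuous (f : cfun) : continuous f.
Proof. by have /asboolP := cfunP f. Qed.

Lemma continuous_subring : subring_closed continuous_pred.
Proof.
split=> [|f g|f g].
- by apply/asboolP; exact: cst_continuous.
- move=> /asboolP cf /asboolP cg; apply/asboolP => x.
  by apply: cvgB; [exact: cf|exact: cg].
- move=> /asboolP cf /asboolP cg; apply/asboolP => x.
  by apply: cvgM; [exact: cf|exact: cg].
Qed.

Lemma continuous_scaler : GRing.scaler_closed continuous_pred.
Proof.
move=> k f /asboolP cf; apply/asboolP => x.
by apply: cvgM; [exact: cvg_cst|exact: cf].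
Qed.

HB.instance Definition _ := GRing.isSubringClosed.Build (X -> Cx R)
  continuous_pred continuous_subring.
HB.instance Definition _ := GRing.isScaleClosed.Build (Cx R) (X -> Cx R)
  continuous_pred continuous_scaler.
HB.instance Definition _ := GRing.SubChoice_isSubComPzRing.Build (X -> Cx R)
  continuous_pred cfun continuous_subring.
HB.instance Definition _ := [SubZmodule_isSubLmodule of cfun by <:].

Lemma cfunD (f g : cfun) (x : X) : (f + g) x = f x + g x.
Proof. by []. Qed.

Lemma cfunZ (k : Cx R) (f : cfun) (x : X) : (k *: f) x = k * f x.
Proof. by []. Qed.

Lemma cfunM (f g : cfun) (x : X) : (f * g) x = f x * g x.
Proof. by []. Qed.

Lemma cfun_eqP (f g : cfun) : (forall x, f x = g x) -> f = g.
Proof. by move=> fg; apply/val_inj/funext. Qed.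

Lemma cfun_bounded (f : cfun) : abs_bounded [set: X] f.
Proof.
have cabs : continuous (fun x : X => Cabs (f x)).
  move=> x; apply/cvgrPdist_lt => e e0.
  have e0' : 0 < Creal e by rewrite -Creal0 ltr_Creal.
  have /cvgrPdist_lt/(_ _ e0') := @cfun_continuous f x.
  apply: filterS => y fxy; rewrite -ltr_Creal -Creal_norm.
  apply: le_lt_trans fxy; rewrite /Creal rmorphB/=.
  rewrite -!/(Creal _) -!CabsE; exact: ler_dist_dist.
have /compact_bounded[M [_ fM]] : compact [set Cabs (f x) | x in [set: X]].
  apply: continuous_compact; last exact: compact_setT.
  exact: continuous_subspaceT.
exists (Creal (M + 1)) => x _; rewrite CabsE ler_Creal.
apply: le_trans (ler_norm _) _; apply: fM; first by rewrite ltrDl.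
by exists x.
Qed.

Definition supnorm (f : cfun) : Cx R := sup_abs [set: X] f.

Lemma supnormD (f g : cfun) : supnorm (f + g) <= supnorm f + supnorm g.
Proof.
rewrite /supnorm (_ : (f + g : X -> _) = fun x => f x + g x).
  by apply: sup_absD; exact: cfun_bounded.
by apply/funext => x; rewrite cfunD.
Qed.

Lemma supnormZ (k : Cx R) (f : cfun) : supnorm (k *: f) = `|k| * supnorm f.
Proof.
rewrite /supnorm (_ : (k *: f : X -> _) = fun x => k * f x).
  by apply: sup_absZ; exact: cfun_bounded.
by apply/funext => x; rewrite cfunZ.
Qed.

Lemma supnorm0_eq0 (f : cfun) : supnorm f = 0 -> f = 0.
Proof.
move=> f0; apply: cfun_eqP => x; apply/eqP; rewrite -normr_le0 -f0.
by apply: abs_le_sup_abs => //; exact: cfun_bounded.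
Qed.

HB.instance Definition _ :=
  Lmodule_isNormed.Build (Cx R) cfun supnormD supnormZ supnorm0_eq0.

Lemma cfun_normE (f : cfun) : `|f| = sup_abs [set: X] f.
Proof. by []. Qed.

Lemma cfun_normM (f g : cfun) : `|f * g| <= `|f| * `|g|.
Proof.
rewrite !cfun_normE; apply: sup_abs_le => [|x _].
  by rewrite mulr_ge0 ?sup_abs_ge0.
rewrite cfunM normrM ler_pM//.
- by apply: abs_le_sup_abs => //; exact: cfun_bounded.
- by apply: abs_le_sup_abs => //; exact: cfun_bounded.
Qed.

End ContinuousFunctions.

Section Dual.
Variables (R : realType) (V : normedModType (Cx R)).

Definition dual_pred : {pred V -> Cx R} :=
  fun phi => `[< scalar phi /\ continuous phi >].

Record dual := Dual {
  dual_val :> V -> Cx R;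
  dualP : dual_val \in dual_pred
}.

HB.instance Definition _ := [isSub for dual_val].
HB.instance Definition _ := [Choice of dual by <:].

Lemma dual_scalar (phi : dual) : scalar phi.
Proof. by have /asboolP[] := dualP phi. Qed.

Lemma dual_continuous (phi : dual) : continuous phi.
Proof. by have /asboolP[] := dualP phi. Qed.

Lemma dual_submod : GRing.subsemimod_closed dual_pred.
Proof.
split; first split.
- apply/asboolP; split=> [k u v|]; last exact: cst_continuous.
  by rewrite -[LHS]/(0 : Cx R) -[RHS]/(k * 0 + 0 : Cx R) mulr0 addr0.
- move=> phi psi /asboolP[lp cp] /asboolP[ls cs]; apply/asboolP; split.
    move=> k u v; rewrite -[LHS]/(phi (k *: u + v) + psi (k *: u + v)).
    by rewrite lp ls addrACA -mulrDr.
  by move=> v; apply: cvgD; [exact: cp|exact: cs].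
- move=> k phi /asboolP[lp cp]; apply/asboolP; split.
    move=> l u v; rewrite -[LHS]/(k * phi (l *: u + v)) lp.
    by rewrite mulrDr mulrCA.
  by move=> v; apply: cvgM; [exact: cvg_cst|exact: cp].
Qed.

Lemma dual_oppr : oppr_closed dual_pred.
Proof.
move=> phi /(dual_submod.2 (-1)); rewrite scaleN1r; exact.
Qed.

HB.instance Definition _ := GRing.isAddClosed.Build (V -> Cx R) dual_pred
  dual_submod.1.
HB.instance Definition _ := GRing.isOppClosed.Build (V -> Cx R) dual_pred
  dual_oppr.
HB.instance Definition _ := GRing.isScaleClosed.Build (Cx R) (V -> Cx R)
  dual_pred dual_submod.2.
HB.instance Definition _ := [SubChoice_isSubLmodule of dual by <:].

HB.instance Definition _ (phi : dual) :=
  GRing.isSemilinear.Build (Cx R) V (Cx R) *%R phi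
    (GRing.semilinear_linear (dual_scalar phi)).

Lemma dualD (phi psi : dual) (v : V) : (phi + psi) v = phi v + psi v.
Proof. by []. Qed.

Lemma dualZ (k : Cx R) (phi : dual) (v : V) : (k *: phi) v = k * phi v.
Proof. by []. Qed.

Lemma dual_eqP (phi psi : dual) : (forall v, phi v = psi v) -> phi = psi.
Proof. by move=> e; apply/val_inj/funext. Qed.

Lemma dual_bounded (phi : dual) : abs_bounded [set v : V | `|v| <= 1] phi.
Proof.
have /linear_bounded_continuous/bounded_funP/(_ 1)[M phiM] :=
  @dual_continuous phi.
by exists M => v; exact: phiM.
Qed.

Definition opnorm (phi : dual) : Cx R := sup_abs [set v : V | `|v| <= 1] phi.

Lemma opnormD (phi psi : dual) : opnorm (phi + psi) <= opnorm phi + opnorm psi.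
Proof.
rewrite /opnorm (_ : (phi + psi : V -> _) = fun v => phi v + psi v).
  by apply: sup_absD; exact: dual_bounded.
by apply/funext => v; rewrite dualD.
Qed.

Lemma opnormZ (k : Cx R) (phi : dual) : opnorm (k *: phi) = `|k| * opnorm phi.
Proof.
rewrite /opnorm (_ : (k *: phi : V -> _) = fun v => k * phi v).
  by apply: sup_absZ; exact: dual_bounded.
by apply/funext => v; rewrite dualZ.
Qed.

Lemma opnorm0_eq0 (phi : dual) : opnorm phi = 0 -> phi = 0.
Proof.
move=> phi0; apply: dual_eqP => v.
have [->|v0] := eqVneq v 0; first exact: linear0.
have nv0 : `|v| != 0 by rewrite normr_eq0.
have : phi (`|v|^-1 *: v) = 0.
  apply/eqP; rewrite -normr_le0 -phi0.
  apply: abs_le_sup_abs; first exact: dual_bounded.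
  by rewrite /= normrZ normfV normr_id mulVf.
rewrite linearZ/= => /eqP; rewrite mulf_eq0 invr_eq0 (negbTE nv0)/=.
by move=> /eqP.
Qed.

HB.instance Definition _ :=
  Lmodule_isNormed.Build (Cx R) dual opnormD opnormZ opnorm0_eq0.

End Dual.

Section Subalgebra.
Variables (R : realType) (X : compactHausdorffType).

(* subring_closed includes 1 \in A, so A contains the constants. *)
Record subalgebra := Subalgebra {
  subalgebra_pred :> {pred cfun R X};
  subalgebra_subring : subring_closed subalgebra_pred;
  subalgebra_scaler : GRing.scaler_closed subalgebra_pred
}.

Variable A : subalgebra.

Record elt := Elt {
  elt_val :> cfun R X;
  eltP : elt_val \in subalgebra_pred A
}.

HB.instance Definition _ := [isSub for elt_val].
HB.instance Definition _ := [Choice of elt by <:].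
HB.instance Definition _ := GRing.isSubringClosed.Build (cfun R X)
  (subalgebra_pred A) (subalgebra_subring A).
HB.instance Definition _ := GRing.isScaleClosed.Build (Cx R) (cfun R X)
  (subalgebra_pred A) (@subalgebra_scaler A).
HB.instance Definition _ := GRing.SubChoice_isSubComPzRing.Build (cfun R X)
  (subalgebra_pred A) elt (subalgebra_subring A).
HB.instance Definition _ := [SubZmodule_isSubLmodule of elt by <:].

Definition elt_norm (a : elt) : Cx R := `|elt_val a|.

Lemma elt_normD (a b : elt) :
  elt_norm (a + b) <= elt_norm a + elt_norm b.
Proof. exact: ler_normD. Qed.

Lemma elt_normZ (k : Cx R) (a : elt) :
  elt_norm (k *: a) = `|k| * elt_norm a.
Proof. exact: normrZ. Qed.

Lemma elt_norm0_eq0 (a : elt) : elt_norm a = 0 -> a = 0.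
Proof. by move=> /eqP; rewrite normr_eq0 => /eqP a0; exact: val_inj. Qed.

HB.instance Definition _ := Lmodule_isNormed.Build (Cx R) elt
  elt_normD elt_normZ elt_norm0_eq0.

Lemma elt_normE (a : elt) : `|a| = `|elt_val a|.
Proof. by []. Qed.

Lemma elt_valM (a b : elt) :
  elt_val (a * b) = elt_val a * elt_val b.
Proof. by []. Qed.

Lemma elt_valZ (k : Cx R) (a : elt) : elt_val (k *: a) = k *: elt_val a.
Proof. by []. Qed.

Lemma elt_scalerAl (k : Cx R) (a b : elt) : k *: (a * b) = k *: a * b.
Proof.
apply/val_inj/cfun_eqP => x.
rewrite -[val _]/(elt_val _) -[val (_ * b)]/(elt_val _).
by rewrite elt_valZ !elt_valM elt_valZ cfunZ !cfunM cfunZ mulrA.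
Qed.

Lemma elt_normM (a b : elt) : `|a * b| <= `|a| * `|b|.
Proof. rewrite !elt_normE elt_valM; exact: cfun_normM. Qed.

End Subalgebra.

Section UniformAlgebra.
Variables (R : realType) (X : compactHausdorffType).

Definition separates_points (A : subalgebra R X) :=
  forall x y : X, x <> y -> exists a : elt A, a x <> a y.

Definition is_character (A : subalgebra R X) (chi : elt A -> Cx R) :=
  [/\ scalar chi, {morph chi : a b / a * b} & exists a, chi a <> 0].

Definition uniform_algebra (A : subalgebra R X) :=
  [/\ closed [set f : cfun R X | f \in A],
      separates_points A &
      forall chi : elt A -> Cx R, is_character chi ->
        exists x : X, forall a : elt A, chi a = a x].

Definition separable (T : topologicalType) :=
  exists2 S : set T, countable S & dense S.

Definition is_essential_set (A : subalgebra R X) (E : set X) :=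
  let P := [set F : set X | closed F /\
    forall f : cfun R X, (forall x, F x -> f x = 0) -> f \in A] in
  P E /\ forall F, P F -> E `<=` F.

Definition essential (A : subalgebra R X) := is_essential_set A [set: X].

Definition locally_constant_on (U : set X) (f : X -> Cx R) :=
  forall x, U x -> \forall y \near x, f y = f x.

Definition lc (A : subalgebra R X) : set (elt A) :=
  [set a | exists U : set X, [/\ open U, dense U & locally_constant_on U a]].

End UniformAlgebra.

Arguments lc {R X} A _.

Section DualBimodule.
Variables (R : realType) (X : compactHausdorffType) (A : subalgebra R X).

Lemma elt_mulr_continuous (a : elt A) : continuous (fun b : elt A => b * a).
Proof.
move=> b; apply/(@cvgrPdist_lt _ _ _ (nbhs b)) => e e0.
have a1 : 0 < `|a| + 1 by rewrite ltr_pwDr.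
apply/(@nbhs_normP (Cx R) (elt A)); exists (e / (`|a| + 1)).
  by rewrite /= divr_gt0.
move=> c /=; rewrite ltr_pdivlMr// => bc.
rewrite -mulrBl; apply: le_lt_trans (elt_normM _ _) _.
by apply: le_lt_trans bc; rewrite ler_wpM2l// lerDl.
Qed.

Lemma lact_subproof (a : elt A) (phi : dual (elt A)) :
  (fun b : elt A => phi (b * a)) \in dual_pred (V := elt A).
Proof.
apply/asboolP; split=> [k u v|v].
  by rewrite mulrDl -elt_scalerAl dual_scalar.
apply: (@continuous_comp _ _ _ (fun b : elt A => b * a) phi).
  exact: elt_mulr_continuous.
exact: dual_continuous.
Qed.

Lemma ract_subproof (phi : dual (elt A)) (a : elt A) :
  (fun b : elt A => phi (a * b)) \in dual_pred (V := elt A).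
Proof.
rewrite (_ : (fun b : elt A => phi (a * b)) = (fun b : elt A => phi (b * a))).
  exact: lact_subproof.
by apply/funext => b; rewrite mulrC.
Qed.

Definition lact (a : elt A) (phi : dual (elt A)) : dual (elt A) :=
  Dual (lact_subproof a phi).
Definition ract (phi : dual (elt A)) (a : elt A) : dual (elt A) :=
  Dual (ract_subproof phi a).

Definition derivation (D : elt A -> dual (elt A)) :=
  linear D /\ forall a b : elt A, D (a * b) = ract (D a) b + lact a (D b).

End DualBimodule.

(* Main.v *)
Require Import Defs.
From HB Require Import structures.
From mathcomp Require Import all_boot all_order all_algebra.
From mathcomp Require cyclic separable cyclotomic.
From mathcomp Require Import complex ring lra.
From mathcomp Require Import all_classical all_reals all_analysis.

Set Implicit Arguments.
Unset Strict Implicit.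
Unset Printing Implicit Defensive.

Import Order.TTheory GRing.Theory Num.Theory numFieldNormedType.Exports.
Local Open Scope classical_set_scope.
Local Open Scope ring_scope.

(* The space X consists of the closed unit disc, placed at height 0, and of small closed discs of
   radius 2^-n about points w_n, placed at height 2^-n, where (w_n) is dense in the unit disc and
   takes its values infinitely often. Let A be the algebra of the continuous functions on X that are
   on each of these discs a uniform limit of polynomials. The small discs have dense union in X, so A
   is essential, because it is essential on each of them. The function f equal to z on the disc at
   height 0 and to w_n on the n-th small disc is continuous and locally constant on the union of the
   small discs, but its derivative at the origin of the disc at height 0 is 1: hence the derivation
   a |-> a'(0) ev_0 does not annihilate f. *)

(** * Complex absolute values *)

(** Polynomials stand in for holomorphic functions throughout. The mean value property becomes an
    average over roots of unity of order greater than the degree; this gives both the maximum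
    principle and a bound on the linear coefficient, hence a derivative at the origin for uniform
    limits of polynomials. What lets a locally constant function have a non-zero derivative
    somewhere is that uniform closeness controls values and not derivatives: membership in A is a
    condition on each disc separately, and only continuity ties the discs together. As the n-th disc
    has radius 2^-n, replacing z by w_n there costs at most 2^-n, which vanishes in the limit. The
    heights 2^-n are isolated, so each small disc is clopen and its indicator is an idempotent of A.
    These idempotents confine a character to one small disc or, when it kills all of them, to the
    disc at height 0. Values of (w_n) recur because every point at height 0 must be approached by
    discs of arbitrarily large index. *)

Section ComplexAbs.
Variable R : realType.
Implicit Types (z w : Cx R) (r s : R).

Lemma Creal_inj : injective (@Creal R).
Proof. by move=> r s []. Qed.

Lemma Cabs_ge0 z : 0 <= Cabs z.
Proof. by rewrite -ler_Creal -CabsE Creal0. Qed.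

Lemma Cabs_Creal r : Cabs (Creal r) = `|r|.
Proof. by apply: Creal_inj; rewrite -CabsE Creal_norm. Qed.

Lemma CabsM z w : Cabs (z * w) = Cabs z * Cabs w.
Proof.
by apply: Creal_inj; rewrite /Creal rmorphM/= -!/(Creal _) -!CabsE normrM.
Qed.

Lemma CabsN z : Cabs (- z) = Cabs z.
Proof. by rewrite /Cabs normrN. Qed.

Lemma CabsBC z w : Cabs (z - w) = Cabs (w - z).
Proof. by rewrite /Cabs distrC. Qed.

Lemma CabsD z w : Cabs (z + w) <= Cabs z + Cabs w.
Proof.
by rewrite -ler_Creal /Creal rmorphD/= -!/(Creal _) -!CabsE ler_normD.
Qed.

Lemma CabsB z w : Cabs (z - w) <= Cabs z + Cabs w.
Proof. by rewrite -(CabsN w) CabsD. Qed.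

Lemma Cabs_distD v z w : Cabs (z - w) <= Cabs (z - v) + Cabs (v - w).
Proof. by apply: le_trans (CabsD _ _); rewrite addrA subrK. Qed.

Lemma Cabs_dist z w : `|Cabs z - Cabs w| <= Cabs (z - w).
Proof.
have := CabsD (z - w) w; have := CabsD (w - z) z; rewrite !subrK (CabsBC w z).
by move=> h1 h2; rewrite ler_norml; apply/andP; split; lra.
Qed.

Lemma Cabs0 : Cabs (0 : Cx R) = 0.
Proof. by rewrite /Cabs normr0. Qed.

Lemma Cabs1 : Cabs (1 : Cx R) = 1.
Proof. by rewrite /Cabs normr1. Qed.

Lemma Cabs_nat n : Cabs (n%:R : Cx R) = n%:R.
Proof. by rewrite -(rmorph_nat (real_complex R)) Cabs_Creal normr_nat. Qed.

Lemma CabsX z n : Cabs (z ^+ n) = Cabs z ^+ n.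
Proof. by elim: n => [|n IH]; rewrite ?expr0 ?Cabs1// !exprS CabsM IH. Qed.

Lemma Cabs_eq0 z : (Cabs z == 0) = (z == 0).
Proof.
apply/eqP/eqP => [h|->]; last exact: Cabs0.
by apply/eqP; rewrite -normr_eq0 CabsE h.
Qed.

Lemma Cabs_sum n (F : 'I_n -> Cx R) :
  Cabs (\sum_(i < n) F i) <= \sum_(i < n) Cabs (F i).
Proof.
elim/big_ind2: _ => [|x x' y y' hx hy|//]; first by rewrite Cabs0.
exact: le_trans (CabsD _ _) (lerD hx hy).
Qed.

Lemma Cabs_le_eps z : (forall e, 0 < e -> Cabs z <= e) -> z = 0.
Proof.
move=> h; apply/eqP; rewrite -Cabs_eq0 eq_le Cabs_ge0 andbT.
by apply/ler_addgt0Pr => e /h; rewrite add0r.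
Qed.

(** Errors of products contain terms of order e^2; the cap e <= 1 makes them linear in e and still
    lets e tend to 0. *)
Lemma Cabs_le_Meps z K :
  (forall e, 0 < e -> e <= 1 -> Cabs z <= K * e) -> z = 0.
Proof.
move=> h; apply: Cabs_le_eps => e e0.
have K1 : 0 < `|K| + 1 by rewrite ltr_wpDl.
pose d := Num.min 1 (e / (`|K| + 1)).
have d0 : 0 < d by rewrite lt_min ltr01 divr_gt0.
have d1 : d <= 1 by rewrite ge_min lexx.
have d2 : d * (`|K| + 1) <= e by rewrite -ler_pdivlMr// ge_min lexx orbT.
apply: le_trans (h d d0 d1) _; apply: le_trans d2.
have := ler_norm K; nra.
Qed.

Definition Cre z : R := complex.Re z.
Definition Cim z : R := complex.Im z.

Lemma CreB z w : Cre (z - w) = Cre z - Cre w.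
Proof. by case: z => ? ?; case: w. Qed.

Lemma CimB z w : Cim (z - w) = Cim z - Cim w.
Proof. by case: z => ? ?; case: w. Qed.

Lemma Cabs_sqrt z : Cabs z = Num.sqrt (Cre z ^+ 2 + Cim z ^+ 2).
Proof. by case: z. Qed.

Lemma Cre_le_Cabs z : `|Cre z| <= Cabs z.
Proof. by rewrite Cabs_sqrt -sqrtr_sqr ler_wsqrtr// lerDl sqr_ge0. Qed.

Lemma Cim_le_Cabs z : `|Cim z| <= Cabs z.
Proof. by rewrite Cabs_sqrt -sqrtr_sqr ler_wsqrtr// lerDr sqr_ge0. Qed.

Lemma Cabs_le_ReIm z : Cabs z <= `|Cre z| + `|Cim z|.
Proof.
rewrite Cabs_sqrt -[leRHS]ger0_norm ?addr_ge0// -sqrtr_sqr ler_wsqrtr//.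
rewrite sqrrD !real_normK ?num_real// [leRHS]addrAC lerDl.
by rewrite mulrn_wge0// mulr_ge0.
Qed.

End ComplexAbs.

(** * Maximum principle for polynomials *)

Section MaximumPrinciple.
Variable R : realType.

(** X^n - 1 splits, and it is separable in characteristic 0, so it has n distinct roots; among n
    distinct n-th roots of unity one is primitive. *)
Lemma closed_prim_root_exists (F : numClosedFieldType) n :
  (0 < n)%N -> exists z : F, n.-primitive_root z.
Proof.
move=> n_gt0; have [r Dp] := closed_field_poly_normal ('X^n - 1 : {poly F}).
rewrite (monicP _) ?monicXnsubC // scale1r in Dp.
have rn1 : all n.-unity_root r by apply/allP=> z; rewrite -root_prod_XsubC -Dp.
have sz_r : (n < (size r).+1)%N.
  by rewrite -(size_prod_XsubC r id) -Dp size_XnsubC.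
have [|z] := hasP (cyclic.has_prim_root n_gt0 rn1 _ sz_r); last by exists z.
by rewrite -separable.separable_prod_XsubC -Dp cyclotomic.separable_Xn_sub_1 // pnatr_eq0 -lt0n.
Qed.

(** For 0 < j < n the geometric sum of the powers of z^j vanishes, so of all the coefficients of p
    only the constant one survives. The size bound excludes exponents that are non-zero multiples of
    n. *)
Lemma sum_prim_root (F : fieldType) n (z : F) (p : {poly F}) :
  n.-primitive_root z -> (size p <= n)%N ->
  \sum_(k < n) p.[z ^+ k] = p`_0 *+ n.
Proof.
move=> prim_z sz_p; have n_gt0 := prim_order_gt0 prim_z.
under eq_bigr => k _ do rewrite (horner_coef_wide _ sz_p).
rewrite exchange_big/= (bigD1 (Ordinal n_gt0))//= [X in _ + X]big1 ?addr0.
  under eq_bigr => k _ do rewrite expr0 mulr1.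
  by rewrite sumr_const card_ord.
move=> j j0; rewrite -mulr_sumr.
have zj1 : z ^+ j - 1 != 0.
  rewrite subr_eq0 -(prim_order_dvd prim_z) gtnNdvd ?ltn_ord//.
  by rewrite lt0n; apply: contra j0 => /eqP j0; apply/eqP/val_inj.
have /eqP : (z ^+ j - 1) * \sum_(k < n) (z ^+ j) ^+ k = 0.
  by rewrite -subrX1 exprAC (prim_expr_order prim_z) expr1n subrr.
rewrite mulf_eq0 (negbTE zj1)/= => /eqP sum0.
by under eq_bigr => k _ do rewrite exprAC; rewrite sum0 mulr0.
Qed.

Lemma Cabs_unity_root n (z : Cx R) k : n.-primitive_root z -> Cabs (z ^+ k) = 1.
Proof.
move=> prim_z; rewrite CabsX.
suff -> : Cabs z = 1 by rewrite expr1n.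
have := prim_expr_order prim_z => /(congr1 (@Cabs R)); rewrite CabsX Cabs1.
move=> h; apply/eqP.
by rewrite -(@eqrXn2 _ n) ?(prim_order_gt0 prim_z) ?Cabs_ge0 ?ler01// expr1n h.
Qed.

(** p(0) is the average of p over the roots of unity of an order exceeding the degree, and these all
    lie on the unit circle. *)
Lemma max_principle_unit (p : {poly Cx R}) (M : R) :
  (forall z, Cabs z = 1 -> Cabs p.[z] <= M) -> Cabs p.[0] <= M.
Proof.
move=> pM; have [z prim_z] := @closed_prim_root_exists (Cx R) (size p).+1 isT.
have := sum_prim_root prim_z (leqnSn _).
move=> /(congr1 (@Cabs R)); rewrite -mulr_natr CabsM Cabs_nat -horner_coef0.
move=> h; have : Cabs p.[0] * (size p).+1%:R <= M * (size p).+1%:R.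
  rewrite -h; apply: le_trans (Cabs_sum _) _; rewrite mulr_natr.
  rewrite -[X in _ *+ X]card_ord -sumr_const; apply: ler_sum => k _.
  by apply: pM; exact: Cabs_unity_root prim_z.
by rewrite ler_pM2r// ltr0n.
Qed.

Lemma max_principle (p : {poly Cx R}) (c : Cx R) (s M : R) : 0 < s ->
  (forall z, Cabs (z - c) = s -> Cabs p.[z] <= M) -> Cabs p.[c] <= M.
Proof.
move=> s0 pM; have := @max_principle_unit (p \Po (Creal s *: 'X + c%:P)) M.
have hE z : (Creal s *: 'X + c%:P).[z] = Creal s * z + c.
  by rewrite hornerD hornerZ hornerX hornerC.
rewrite horner_comp hE mulr0 add0r; apply => z z1.
rewrite horner_comp hE; apply: pM.
by rewrite addrK CabsM Cabs_Creal z1 mulr1 gtr0_norm.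
Qed.

(** A weak Cauchy estimate. Writing p = q X + a, the coefficient is q(0), and on the unit circle
    |q(z)| = |p(z) - p(0)| <= 2 M, so the maximum principle applies to q. *)
Lemma coef1_bound (p : {poly Cx R}) (M : R) :
  (forall z, Cabs z <= 1 -> Cabs p.[z] <= M) -> Cabs p`_1 <= 2 * M.
Proof.
(* Only the decomposition q X + a is wanted here; the induction hypothesis is discarded. *)
elim/poly_ind: p => [|q a _] pM.
  rewrite coef0 Cabs0 mulr_ge0//; apply: le_trans (Cabs_ge0 _) (pM 0 _).
  by rewrite Cabs0.
have qE z : (q * 'X + a%:P).[z] = q.[z] * z + a.
  by rewrite hornerD hornerM hornerX hornerC.
rewrite coefD coefMX coefC/= addr0 -horner_coef0.
apply: max_principle_unit => z z1.
have := pM z; rewrite qE z1 => /(_ (lexx _)) h1.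
have := pM 0; rewrite qE Cabs0 mulr0 add0r => /(_ ler01) h2.
have -> : Cabs q.[z] = Cabs ((q.[z] * z + a) - a).
  by rewrite addrK CabsM z1 mulr1.
by apply: le_trans (CabsB _ _) _; lra.
Qed.

End MaximumPrinciple.

Lemma injective_unbounded (f : nat -> nat) N : injective f ->
  exists k, (N <= f k)%N.
Proof.
move=> inj_f; apply: contrapT => /forallNP fN.
have fltN k : (f k < N)%N by rewrite ltnNge; apply/negP.
have /leq_card : injective (fun k : 'I_N.+1 => Ordinal (fltN k)).
  by move=> i j /(congr1 val)/= /inj_f /val_inj.
by rewrite !card_ord ltnn.
Qed.

(** * Convergence and compactness in the complex plane by means of real distances *)

Section Topology.
Variable R : realType.

(** The norm of [Cx R] is [Cx R]-valued, and so are the radii of its balls; this criterion allows a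
    real e in all later estimates. *)
Lemma cvg_CabsP (T : Type) (F : set_system T) {FF : Filter F}
    (f : T -> Cx R) (l : Cx R) :
  f @ F --> l <-> forall e : R, 0 < e -> \forall x \near F, Cabs (f x - l) < e.
Proof.
split=> [/cvgrPdist_lt fl e e0|fl].
  have e0' : 0 < Creal e by rewrite -Creal0 ltr_Creal.
  apply: filterS (fl _ e0') => x; rewrite CabsE ltr_Creal.
  by rewrite CabsBC.
apply/cvgrPdist_lt => e e0; have [r r0 eE] := ge0_Creal (ltW e0).
move: e0; rewrite eE -Creal0 ltr_Creal => /fl; apply: filterS => x.
by rewrite CabsBC CabsE ltr_Creal.
Qed.

Lemma nbhs_Cabs (z : Cx R) (e : R) : 0 < e -> nbhs z [set w | Cabs (w - z) < e].
Proof. by move=> e0; exact: ((@cvg_CabsP _ (nbhs z) _ id z).1 cvg_id). Qed.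

Lemma nbhs_CabsP (z : Cx R) (A : set (Cx R)) : nbhs z A ->
  exists2 e : R, 0 < e & forall w, Cabs (w - z) < e -> A w.
Proof.
move=> /nbhs_normP[e /= e0 eA]; have [r r0 eE] := ge0_Creal (ltW e0).
exists r; first by move: e0; rewrite eE -Creal0 ltr_Creal.
by move=> w zw; apply: eA; rewrite /= eE CabsE ltr_Creal CabsBC.
Qed.

Lemma Cabs_continuous : continuous (@Cabs R).
Proof.
move=> z; apply/(@cvgrPdist_lt _ _ _ (nbhs z) (nbhs_filter z)) => e e0.
apply: (@filterS _ (nbhs z) (nbhs_filter z) _ _ _ (nbhs_Cabs z e0)) => w /=.
by apply: le_lt_trans; rewrite distrC Cabs_dist.
Qed.

Definition square (r : R) : set (Cx R) := [set z | `|Cre z| <= r /\ `|Cim z| <= r].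

Lemma square_compact r : compact (square r).
Proof.
have -> : square r = (fun p : R * R => Complex p.1 p.2 : Cx R) @`
    (`[- r, r]%classic `*` `[- r, r]%classic).
  apply/seteqP; split=> [[a b] [/= ar br]|_ [[a b] [/= ar br] <-]].
    by exists (a, b) => //=; rewrite !in_itv/= -!ler_norml.
  by move: ar br; rewrite !in_itv/= -!ler_norml.
apply: continuous_compact; last exact/compact_setX/segment_compact/segment_compact.
apply: continuous_subspaceT => -[a b]; apply/cvg_CabsP => e e0.
have e2 : 0 < e / 2 by rewrite divr_gt0.
have ha : nbhs a [set x | `|a - x| < e / 2] by exact: nbhsx_ballx.
have hb : nbhs b [set x | `|b - x| < e / 2] by exact: nbhsx_ballx.
exists ([set x | `|a - x| < e / 2], [set x | `|b - x| < e / 2]) => // -[x y] [/= hx hy].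
apply: le_lt_trans (Cabs_le_ReIm _) _; rewrite CreB CimB/= distrC (distrC y).
by rewrite [e]splitr ltrD.
Qed.

End Topology.

(** * The space of discs *)

Section Space.
Variable R : realType.

Definition height (i : option nat) : R := if i is Some n then 2^-1 ^+ n else 0.

Definition disc_radius (i : option nat) : R := if i is Some n then 2^-1 ^+ n else 1.

(* The third component of the code is ignored, so that each value is taken at arbitrarily large n. *)
Definition ratnode (n : nat) : Cx R :=
  if (unpickle n : option (rat * rat * nat)) is Some (a, b, _)
  then Complex (ratr a) (ratr b) else 0.

Definition node n := if Cabs (ratnode n) <= 1 then ratnode n else 0.

Definition disc_center (i : option nat) : Cx R := if i is Some n then node n else 0.

Lemma half_exp_gt0 n : 0 < (2^-1 : R) ^+ n.
Proof. by rewrite exprn_gt0// invr_gt0. Qed.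

Lemma half_exp_le m n : (m <= n)%N -> (2^-1 : R) ^+ n <= 2^-1 ^+ m.
Proof. by move=> mn; rewrite ler_wiXn2l// ?invr_ge0// invf_le1// ler1n. Qed.

Lemma height_ge0 i : 0 <= height i.
Proof. by case: i => [n|]//=; exact/ltW/half_exp_gt0. Qed.

Lemma height_le1 i : height i <= 1.
Proof. by case: i => [n|]/=; [exact: (half_exp_le (leq0n n))|exact: ler01]. Qed.

Lemma disc_radius_gt0 i : 0 < disc_radius i.
Proof. by case: i => [n|]//=; exact: half_exp_gt0. Qed.

Lemma Cabs_node n : Cabs (node n) <= 1.
Proof. by rewrite /node; case: ifPn => // _; rewrite Cabs0. Qed.

(** The height closest to 2^-n is 2^-(n+1), at distance exactly 2^-n / 2, which the strict
    inequality excludes. This makes every small disc open. *)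
Lemma height_isolated n i : `|height i - height (Some n)| < height (Some n) / 2 ->
  i = Some n.
Proof.
case: i => [m|] /=; last first.
  rewrite sub0r normrN gtr0_norm ?half_exp_gt0// => h; exfalso.
  by have := half_exp_gt0 n; lra.
have h (a b : nat) : (a < b)%N -> (2^-1 : R) ^+ b <= 2^-1 ^+ a / 2.
  by move=> /half_exp_le; rewrite exprS mulrC.
have := half_exp_gt0 m; have := half_exp_gt0 n.
rewrite ltr_norml => n0 m0 /andP[h1 h2]; congr Some; apply/eqP.
by rewrite eqn_leq; apply/andP; split; rewrite leqNgt; apply/negP => /h; lra.
Qed.

Lemma half_exp_lt (e : R) : 0 < e -> exists N, forall n, (N <= n)%N -> (2^-1 : R) ^+ n < e.
Proof.
move=> e0.
have : (2^-1 : R) ^+ n @[n --> \oo] --> 0.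
  by apply: cvg_expr; rewrite gtr0_norm ?invr_gt0// invf_lt1// ltr1n.
move=> /cvgrPdist_lt/(_ _ e0)[N _ NP]; exists N => n /NP/=.
by rewrite sub0r normrN gtr0_norm ?half_exp_gt0.
Qed.

Lemma ratnode_near (z : Cx R) (d : R) N : 0 < d ->
  exists2 n, (N <= n)%N & Cabs (ratnode n - z) < d.
Proof.
move=> d0; have d2 : 0 < d / 2 by rewrite divr_gt0.
have [a] : exists q : rat, (ratr q : R) \in `]Cre z, Cre z + d / 2[.
  by apply: rat_in_itvoo; rewrite ltrDl.
have [b] : exists q : rat, (ratr q : R) \in `]Cim z, Cim z + d / 2[.
  by apply: rat_in_itvoo; rewrite ltrDl.
rewrite !in_itv/= => /andP[b1 b2] /andP[a1 a2].
(* Varying the ignored component k keeps the point and makes its code as large as required. *)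
have [k Nk] := @injective_unbounded (fun k => pickle (a, b, k)) N
  (fun k l h => congr1 snd (pcan_inj pickleK h)).
exists (pickle (a, b, k)) => //; rewrite /ratnode pickleK.
apply: le_lt_trans (Cabs_le_ReIm _) _; rewrite CreB CimB/=.
by rewrite !gtr0_norm ?subr_gt0//; lra.
Qed.

(** [node] keeps a rational point only if it lies in the unit disc. Hence z is first shrunk to (1 -
    d) z and that point is approximated within d: the result has modulus at most 1 and is within 2 d
    <= e / 2 of z. *)
Lemma node_near (z : Cx R) (e : R) N : Cabs z <= 1 -> 0 < e ->
  exists2 n, (N <= n)%N & Cabs (node n - z) < e.
Proof.
move=> z1 e0; pose d : R := Num.min 1 (e / 4).
have d0 : 0 < d by rewrite lt_min ltr01 divr_gt0.
have d1 : d <= 1 by rewrite ge_min lexx.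
have d2 : d <= e / 4 by rewrite ge_min lexx orbT.
have [n Nn hn] := ratnode_near (Creal (1 - d) * z) N d0.
exists n => //; rewrite /node.
have h1 : Cabs (Creal (1 - d) * z) <= 1 - d.
  rewrite CabsM Cabs_Creal ger0_norm ?subr_ge0//.
  by rewrite ler_piMr ?subr_ge0.
rewrite ifT; last first.
  rewrite -[ratnode n](subrK (Creal (1 - d) * z)).
  by apply: le_trans (CabsD _ _) _; lra.
apply: le_lt_trans (Cabs_distD (Creal (1 - d) * z) _ _) _.
have h2 : Cabs (Creal (1 - d) * z - z) <= d.
  have -> : Creal (1 - d) * z - z = Creal (- d) * z.
    by rewrite -[X in _ - X]mul1r -mulrBl -(rmorph1 (real_complex R)) -rmorphB addrAC subrr sub0r.
  by rewrite CabsM Cabs_Creal normrN gtr0_norm// ler_piMr// ltW.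
lra.
Qed.

Definition point := {p : option nat * Cx R | Cabs (p.2 - disc_center p.1) <= disc_radius p.1}.

Definition embed (p : point) : R * Cx R := (height (val p).1, (val p).2).

(** The topology comes from R x C and not from the disjoint union, so that the small discs
    accumulate at the disc of index [None]. *)
Definition discs := initial_topology embed.

HB.instance Definition _ := Topological.on discs.

Definition emb : discs -> R * Cx R := embed.

Definition idx (x : discs) : option nat := (val (x : point)).1.
Definition zcoord (x : discs) : Cx R := (val (x : point)).2.

Definition disc_at i z (h : Cabs (z - disc_center i) <= disc_radius i) : discs :=
  exist _ (i, z) h.

Lemma discP (x : discs) : Cabs (zcoord x - disc_center (idx x)) <= disc_radius (idx x).
Proof. exact: (valP (x : point)). Qed.

Lemma disc_inj (x y : discs) : idx x = idx y -> zcoord x = zcoord y -> x = y.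
Proof.
move=> hi hz; apply: (@val_inj _ _ point).
by rewrite [LHS]surjective_pairing [RHS]surjective_pairing -!/(idx _) -!/(zcoord _) hi hz.
Qed.

Lemma height_inj : injective height.
Proof.
have h n j : height (Some n) = height j -> Some n = j.
  move=> hj; apply/esym/height_isolated.
  by rewrite hj subrr normr0 -hj divr_gt0//; exact: half_exp_gt0.
by case=> [n|] [m|]// => [|/h|/esym/h]; first exact: h.
Qed.

Lemma nbhs_discs (x : discs) (V : set discs) : nbhs x V <->
  exists2 d : R, 0 < d & forall y, `|height (idx y) - height (idx x)| < d ->
    Cabs (zcoord y - zcoord x) < d -> V y.
Proof.
split.
  move=> [_ [[B Bo <-] Bx] BV].
  have [[P Q] [/= hP hQ] PQ] : nbhs (emb x) B by exact: open_nbhs_nbhs.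
  have /nbhs_normP[d /= d0 dP] := hP; have [e e0 eQ] := nbhs_CabsP hQ.
  exists (Num.min d e); first by rewrite lt_min d0.
  move=> y; rewrite !lt_min => /andP[h1 _] /andP[_ h2]; apply/BV/PQ.
  by split; [apply: dP; rewrite /= distrC|exact: eQ].
move=> [d d0 dV].
have : nbhs (emb x) [set p | `|height (idx x) - p.1| < d /\ Cabs (p.2 - zcoord x) < d].
  exists ([set t | `|height (idx x) - t| < d], [set z | Cabs (z - zcoord x) < d]) => //=.
  by split; [exact: nbhsx_ballx|exact: nbhs_Cabs].
move=> hn; have : nbhs x (emb @^-1` _) := @initial_continuous point _ embed x _ hn.
apply: filterS => y [/= h1 h2].
by apply: dV; rewrite // distrC.
Qed.

Lemma emb_continuous : continuous emb.
Proof. exact: (@initial_continuous point _ embed). Qed.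

Lemma zcoord_continuous : continuous zcoord.
Proof.
move=> x; apply: (@continuous_comp _ _ _ emb snd); first exact: emb_continuous.
exact: cvg_snd.
Qed.

Lemma height_continuous : continuous (fun x : discs => height (idx x)).
Proof.
move=> x; apply: (@continuous_comp _ _ _ emb fst); first exact: emb_continuous.
exact: cvg_fst.
Qed.

Lemma near_idx (x : discs) n : idx x = Some n -> \forall y \near x, idx y = Some n.
Proof.
move=> xn; apply/nbhs_discs; exists (height (Some n) / 2).
  by rewrite divr_gt0//; exact: half_exp_gt0.
by move=> y; rewrite xn => /height_isolated.
Qed.

Lemma near_height (x : discs) (e : R) : idx x = None -> 0 < e ->
  \forall y \near x, height (idx y) < e.
Proof.
move=> xN e0; apply/nbhs_discs; exists e => // y; rewrite xN subr0.
by rewrite ger0_norm ?height_ge0.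
Qed.

Lemma zcoord_bound (x : discs) : Cabs (zcoord x) <= 1 + height (idx x).
Proof.
have := discP x; case: (idx x) => [n|] /=; last by rewrite subr0 addr0.
move=> h; rewrite -[zcoord x](subrK (node n)); apply: le_trans (CabsD _ _) _.
by rewrite addrC lerD// Cabs_node.
Qed.

Lemma zcoord_le2 (x : discs) : Cabs (zcoord x) <= 2.
Proof. by apply: le_trans (zcoord_bound x) _; have := height_le1 (idx x); lra. Qed.

(** A limit point has height a >= 0. If a > 0, the nearby points all lie on one small disc, which is
    closed. If a = 0, their coordinates have modulus at most 1 plus a height tending to 0, so the
    limit is in the unit disc. *)
Lemma range_emb_closed : closed (range emb).
Proof.
move=> [a b] clab.
have {clab}app (d : R) : 0 < d -> exists x : discs,
    `|a - height (idx x)| < d /\ Cabs (zcoord x - b) < d.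
  move=> d0; have : nbhs (a, b) [set p | `|a - p.1| < d /\ Cabs (p.2 - b) < d].
    exists ([set t | `|a - t| < d], [set z | Cabs (z - b) < d]) => //=.
    by split; [exact: nbhsx_ballx|exact: nbhs_Cabs].
  by move=> /clab[_ [[x _ <-] [/= h1 h2]]]; exists x.
have [a0|a0|a0] := ltgtP a 0.
- have [x [+ _]] := app (- a) ltac:(by rewrite oppr_gt0).
  rewrite ltr_norml => /andP[h _]; exfalso.
  by have := height_ge0 (idx x); lra.
(* Two heights within a / 8 of a differ by less than a / 4, while half of either exceeds 7 a / 16,
   so [height_isolated] identifies their indices. *)
- have [x [hx _]] := app (a / 8) ltac:(by rewrite divr_gt0).
  case xn : (idx x) hx => [n|] hx; last first.
    by exfalso; move: hx; rewrite subr0 gtr0_norm//; lra.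
  have {}app (d : R) : 0 < d -> exists2 y : discs, idx y = Some n &
      `|a - height (Some n)| < d /\ Cabs (zcoord y - b) < d.
    move=> d0; have [|y [h1 h2]] := app (Num.min d (a / 8)).
      by rewrite lt_min d0 divr_gt0.
    move: h1 h2; rewrite !lt_min => /andP[h1 h3] /andP[h2 _].
    have yn : idx y = Some n.
      apply: height_isolated; move: hx h3; rewrite !ltr_norml.
      by move=> /andP[? ?] /andP[? ?]; apply/andP; split; lra.
    by exists y => //; rewrite -yn.
  have an : a = height (Some n).
    apply/eqP; rewrite -subr_eq0 -normr_le0; apply/ler_addgt0Pr => e /app[y _ [h _]].
    by rewrite add0r ltW.
  have bn : Cabs (b - disc_center (Some n)) <= disc_radius (Some n).
    apply/ler_addgt0Pr => e /app[y yn [_ h]].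
    apply: le_trans (Cabs_distD (zcoord y) _ _) _; rewrite CabsBC addrC.
    by apply: lerD (ltW h); rewrite -yn; exact: discP.
  by exists (disc_at bn) => //; rewrite an.
- have b1 : Cabs (b - disc_center None) <= disc_radius None.
    rewrite subr0; apply/ler_addgt0Pr => e e0.
    have [x [h1 h2]] := app (e / 2) ltac:(by rewrite divr_gt0).
    move: h1; rewrite a0 sub0r normrN ger0_norm ?height_ge0// => h1.
    rewrite -[b](subrK (zcoord x)); apply: le_trans (CabsD _ _) _.
    by rewrite CabsBC; have := zcoord_bound x; rewrite /disc_radius; lra.
  by exists (disc_at b1) => //; rewrite a0.
Qed.

Lemma range_emb_compact : compact (range emb).
Proof.
apply: (@subclosed_compact _ _ (`[0 : R, 1]%classic `*` square (2 : R))).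
- exact: range_emb_closed.
- by apply: compact_setX; [exact: segment_compact|exact: square_compact].
- move=> _ [x _ <-]; split; rewrite /= ?in_itv/= ?height_ge0 ?height_le1//.
  have := zcoord_le2 x; rewrite /zcoord => x2.
  by split; apply: le_trans x2; [exact: Cre_le_Cabs|exact: Cim_le_Cabs].
Qed.

(** Every open set is a preimage under [emb], so a cluster point of the image filter in the compact
    range lifts to a cluster point of the filter. *)
Lemma discs_compact : compact [set: discs].
Proof.
move=> F FF _.
have rF : F (emb @^-1` range emb) by apply: filterS filterT => x _ /=; exists x.
have [p [[x _ xp] clx]] := @range_emb_compact (emb @ F) _ rF.
subst p; exists x; split=> // A B FA.
rewrite nbhsE => -[_ [[W Wo <-] Wx] WB].
have FAe : F (emb @^-1` (emb @` A)) by apply: filterS FA => y Ay /=; exists y.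
have [_ [[y Ay <-] Wy]] : (emb @` A) `&` W !=set0 := clx _ _ FAe (open_nbhs_nbhs (conj Wo Wx)).
by exists y; split=> //; exact: WB.
Qed.

Lemma discs_hausdorff : hausdorff_space discs.
Proof.
move=> x y clxy.
have near d : 0 < d -> `|height (idx x) - height (idx y)| <= d /\
    Cabs (zcoord x - zcoord y) <= d.
  move=> d0; have d2 : 0 < d / 2 by rewrite divr_gt0.
  pose V (u : discs) := [set v | `|height (idx v) - height (idx u)| < d / 2 /\
    Cabs (zcoord v - zcoord u) < d / 2].
  have nV u : nbhs u (V u) by apply/nbhs_discs; exists (d / 2).
  have [v [[hx zx] [hy zy]]] := clxy _ _ (nV x) (nV y).
  split; last first.
    by apply: le_trans (Cabs_distD (zcoord v) _ _) _; rewrite CabsBC; lra.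
  apply: le_trans (ler_distD (height (idx v)) _ _) _.
  by rewrite distrC; lra.
have hxy : height (idx x) = height (idx y).
  apply/eqP; rewrite -subr_eq0 -normr_le0; apply/ler_addgt0Pr => e /near[h _].
  by rewrite add0r.
apply: disc_inj; first exact: height_inj.
by apply/eqP; rewrite -subr_eq0; apply/eqP/Cabs_le_eps => e /near[].
Qed.

HB.instance Definition _ :=
  isCompactHausdorff.Build discs discs_compact discs_hausdorff.

End Space.

(** * Continuity of piecewise and polynomial functions; the uniform norm as a real number *)

Lemma continuous_eq_near (T U : topologicalType) (f g : T -> U) (x : T) :
  (\forall y \near x, f y = g y) -> {for x, continuous g} -> {for x, continuous f}.
Proof.
move=> fg cg; have -> : {for x, continuous f} = (f @ x --> g x) :> Prop.
  by rewrite /prop_for/= /continuous_at (nbhs_singleton fg).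
by apply: cvg_trans cg; apply: near_eq_cvg; apply: filterS fg => y ->.
Qed.

Lemma horner_continuous (K : numFieldType) (T : topologicalType) (f : T -> K)
  (p : {poly K}) : continuous f -> continuous (fun x => p.[f x]).
Proof.
move=> cf; elim/poly_ind: p => [|p c IH] x.
  rewrite (_ : (fun x => _) = fun=> 0); first exact: cvg_cst.
  by apply/funext => y; rewrite horner0.
rewrite (_ : (fun x => _) = fun y => p.[f y] * f y + c).
  by apply: cvgD; [apply: cvgM; [exact: IH|exact: cf]|exact: cvg_cst].
by apply/funext => y; rewrite hornerD hornerM hornerX hornerC.
Qed.

Section FunctionNorm.
Variables (R : realType) (X : compactHausdorffType).
Implicit Types f : cfun R X.

Definition fnorm f : R := Cabs (`|f| : Cx R).

Lemma fnormE f : `|f| = Creal (fnorm f) :> Cx R.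
Proof. by rewrite -CabsE normr_id. Qed.

Lemma fnorm_ge0 f : 0 <= fnorm f.
Proof. exact: Cabs_ge0. Qed.

Lemma Cabs_le_fnorm f x : Cabs (f x) <= fnorm f.
Proof.
rewrite -ler_Creal -fnormE -CabsE cfun_normE.
by apply: abs_le_sup_abs => //; exact: cfun_bounded.
Qed.

Lemma fnorm_le f (M : R) : 0 <= M -> (forall x, Cabs (f x) <= M) -> fnorm f <= M.
Proof.
move=> M0 fM; rewrite -ler_Creal -fnormE cfun_normE.
apply: sup_abs_le => [|x _]; first by rewrite -Creal0 ler_Creal.
by rewrite CabsE ler_Creal.
Qed.

End FunctionNorm.

(** * The algebra *)

Section Algebra.
Variable R : realType.
Notation X := (discs R).

Definition fibre_approx (f : X -> Cx R) i := forall e : R, 0 < e ->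
  exists p : {poly Cx R}, forall x, idx x = i -> Cabs (f x - p.[zcoord x]) <= e.

Definition fibrewise_pred : {pred cfun R X} :=
  fun f => `[< forall i, fibre_approx f i >].

Lemma fibre_approx_poly (f : X -> Cx R) i (p : {poly Cx R}) :
  (forall x, idx x = i -> f x = p.[zcoord x]) -> fibre_approx f i.
Proof.
by move=> fp e e0; exists p => x /fp ->; rewrite subrr Cabs0 ltW.
Qed.

Lemma fibre_approxB f g i : fibre_approx f i -> fibre_approx g i ->
  fibre_approx (fun x => f x - g x) i.
Proof.
move=> fa ga e e0; have e2 : 0 < e / 2 by rewrite divr_gt0.
have [p fp] := fa _ e2; have [q gq] := ga _ e2; exists (p - q) => x xi.
rewrite hornerD hornerN opprD addrACA -opprD.
by apply: le_trans (CabsB _ _) _; have := fp _ xi; have := gq _ xi; lra.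
Qed.

(** The modulus of q is bounded through b and b - q, so that the estimate involves the given
    functions and the errors but not the size of the approximating polynomials. *)
Lemma Cabs_mulB (a b p q : Cx R) : Cabs (a * b - p * q) <=
  Cabs a * Cabs (b - q) + (Cabs b + Cabs (b - q)) * Cabs (a - p).
Proof.
have -> : a * b - p * q = a * (b - q) + (b - (b - q)) * (a - p) by ring.
apply: le_trans (CabsD _ _) _; rewrite !CabsM lerD2l.
by rewrite ler_wpM2r ?Cabs_ge0// CabsB.
Qed.

Lemma fibre_approxM (f g : cfun R X) i : fibre_approx f i -> fibre_approx g i ->
  fibre_approx (fun x => f x * g x) i.
Proof.
(* With both errors at most d <= 1, [Cabs_mulB] bounds the error of the product by fnorm f * d +
   (fnorm g + 1) * d = d * K. *)
move=> fa ga e e0; pose K := fnorm f + fnorm g + 1.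
have [f0 g0] := (fnorm_ge0 f, fnorm_ge0 g).
have K0 : 0 < K by rewrite ltr_wpDl ?addr_ge0.
pose d := Num.min 1 (e / K).
have d0 : 0 < d by rewrite lt_min ltr01 divr_gt0.
have d1 : d <= 1 by rewrite ge_min lexx.
have d2 : d * K <= e by rewrite -ler_pdivlMr// ge_min lexx orbT.
have [p fp] := fa _ d0; have [q gq] := ga _ d0; exists (p * q) => x xi.
rewrite hornerM; apply: le_trans (Cabs_mulB _ _ _ _) _; apply: le_trans d2.
have -> : d * K = fnorm f * d + (fnorm g + 1) * d by rewrite /K; ring.
have gx : Cabs (g x - q.[zcoord x]) <= 1 by apply: le_trans (gq _ xi) d1.
apply: lerD; apply: ler_pM; rewrite ?addr_ge0 ?Cabs_ge0 ?Cabs_le_fnorm ?lerD ?fp ?gq//.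
exact: Cabs_le_fnorm.
Qed.

Lemma fibrewise_subring : subring_closed fibrewise_pred.
Proof.
split=> [|f g /asboolP fa /asboolP ga|f g /asboolP fa /asboolP ga].
- apply/asboolP => i; apply: (@fibre_approx_poly _ _ 1) => x _.
  by rewrite hornerC.
- apply/asboolP => i; exact: fibre_approxB.
- apply/asboolP => i; exact: fibre_approxM.
Qed.

Lemma fibrewise_scaler : GRing.scaler_closed fibrewise_pred.
Proof.
move=> k f /asboolP fa; apply/asboolP => i e e0.
have k1 : 0 < Cabs k + 1 by rewrite ltr_wpDl ?Cabs_ge0.
have [p fp] := fa i (e / (Cabs k + 1)) ltac:(by rewrite divr_gt0).
exists (k *: p) => x /fp h; rewrite hornerZ -mulrBr CabsM.
apply: (@le_trans _ _ ((Cabs k + 1) * Cabs (f x - p.[zcoord x]))).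
  by rewrite ler_wpM2r ?Cabs_ge0// lerDl.
by rewrite mulrC -ler_pdivlMr.
Qed.

Definition fibrewise : subalgebra R X :=
  Subalgebra fibrewise_subring fibrewise_scaler.

Notation A := fibrewise.

Lemma eltA_approx (a : elt A) i : fibre_approx a i.
Proof. by have /asboolP := eltP a; apply. Qed.

(** * Explicit elements of the algebra *)

Lemma exists_elt (f : X -> Cx R) : continuous f -> (forall i, fibre_approx f i) ->
  {a : elt A | forall x, a x = f x}.
Proof.
move=> cf fa; have cf' : f \in continuous_pred (R := R) (X := X) by apply/asboolP.
have fA : CFun cf' \in A by apply/asboolP.
by exists (Elt fA).
Qed.

(** The default of [nth] is p itself: beyond the end of s every small disc carries the polynomial of
    the disc at height 0, which gives continuity there. *)
Definition piecewise (p : {poly Cx R}) (s : seq {poly Cx R}) (x : X) : Cx R :=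
  (if idx x is Some n then nth p s n else p).[zcoord x].

Lemma piecewise_elt p s : {a : elt A | forall x, a x = piecewise p s x}.
Proof.
apply: exists_elt => [x|i]; last first.
  by apply: fibre_approx_poly => x xi; rewrite /piecewise xi.
case xi : (idx x) => [n|].
  apply: (@continuous_eq_near X _ _ (fun y => (nth p s n).[zcoord y])).
    by apply: filterS (near_idx xi) => y yn; rewrite /piecewise yn.
  exact: horner_continuous (@zcoord_continuous R) _.
apply: (@continuous_eq_near X _ _ (fun y => p.[zcoord y])); last first.
  exact: horner_continuous (@zcoord_continuous R) _.
apply: filterS (near_height xi (half_exp_gt0 R (size s))) => y.
rewrite /piecewise; case: (idx y) => [n|//] /= h; rewrite nth_default// leqNgt.
by apply/negP => /ltnW/(half_exp_le R); rewrite leNgt h.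
Qed.

Lemma ecoord_exists : {a : elt A | forall x, a x = zcoord x}.
Proof.
have [a aE] := piecewise_elt 'X [::]; exists a => x.
by rewrite aE /piecewise; case: (idx x) => [n|]; rewrite ?nth_nil hornerX.
Qed.

Definition ecoord : elt A := sval ecoord_exists.

Lemma ecoordE x : ecoord x = zcoord x.
Proof. exact: (svalP ecoord_exists). Qed.

Lemma eind_exists n : {a : elt A | forall x, a x = (idx x == Some n)%:R}.
Proof.
have [a aE] := piecewise_elt 0 (rcons (nseq n 0) 1); exists a => x.
rewrite aE /piecewise; case: (idx x) => [m|]; last by rewrite horner0.
have -> : nth 0 (rcons (nseq n 0) 1) m = (m == n)%:R :> {poly Cx R}.
  by rewrite nth_rcons size_nseq nth_nseq if_same; case: ltngtP.
by rewrite -polyC_natr hornerC.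
Qed.

Definition eind n : elt A := sval (eind_exists n).

Lemma eindE n x : eind n x = (idx x == Some n)%:R.
Proof. exact: (svalP (eind_exists n)). Qed.

Lemma etail_exists N : {a : elt A |
  forall x, a x = (if idx x is Some n then (N <= n)%N else true)%:R}.
Proof.
have [a aE] := piecewise_elt 1 (nseq N 0); exists a => x.
rewrite aE /piecewise; case: (idx x) => [n|]; last by rewrite hornerC.
by rewrite nth_nseq ltnNge; case: leqP => _ /=; rewrite hornerC.
Qed.

Definition etail N : elt A := sval (etail_exists N).

Lemma etailE N x : etail N x = (if idx x is Some n then (N <= n)%N else true)%:R.
Proof. exact: (svalP (etail_exists N)). Qed.

Lemma epoly_exists p : {a : elt A | forall x, a x = p.[zcoord x]}.
Proof.
have [a aE] := piecewise_elt p [::]; exists a => x.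
by rewrite aE /piecewise; case: (idx x) => [n|]; rewrite ?nth_nil.
Qed.

Definition epoly p : elt A := sval (epoly_exists p).

Lemma epolyE p x : epoly p x = p.[zcoord x].
Proof. exact: (svalP (epoly_exists p)). Qed.

Definition nodal (x : X) : Cx R := if idx x is Some n then node R n else zcoord x.

(** The radius of a small disc equals its height, so the distance to the centre tends to 0 towards
    height 0; continuity of [nodal] rests on this. *)
Lemma nodal_dist x : Cabs (nodal x - zcoord x) <= height R (idx x).
Proof.
rewrite /nodal; have := discP x; case: (idx x) => [n|] /=.
  by rewrite CabsBC.
by rewrite subrr Cabs0.
Qed.

Lemma nodal_continuous : continuous nodal.
Proof.
move=> x; case xi : (idx x) => [n|].
  apply: (@continuous_eq_near X _ _ (fun=> node R n)); last exact: cst_continuous.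
  by apply: filterS (near_idx xi) => y yn; rewrite /nodal yn.
apply/(@cvg_CabsP _ _ (nbhs x) (nbhs_filter x)) => e e0.
have e2 : 0 < e / 2 by rewrite divr_gt0.
apply/nbhs_discs; exists (e / 2) => // y.
rewrite xi subr0 ger0_norm ?height_ge0// => h1 h2.
have -> : nodal x = zcoord x by rewrite /nodal xi.
apply: le_lt_trans (Cabs_distD (zcoord y) _ _) _.
by have := nodal_dist y; lra.
Qed.

Lemma nodal_elt : {a : elt A | forall x, a x = nodal x}.
Proof.
apply: exists_elt; first exact: nodal_continuous.
case=> [n|].
  by apply: (@fibre_approx_poly _ _ (node R n)%:P) => x xn; rewrite /nodal xn hornerC.
by apply: (@fibre_approx_poly _ _ 'X) => x xn; rewrite /nodal xn hornerX.
Qed.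

(** * Separation of points and closedness *)

Lemma elt_eqP (a b : elt A) : (forall x, a x = b x) -> a = b.
Proof. by move=> ab; apply/val_inj/cfun_eqP. Qed.

Lemma idx_separates (x y : X) : idx x <> idx y -> exists a : elt A, a x <> a y.
Proof.
have sep n (u v : X) : idx u = Some n -> idx v <> Some n -> eind n u <> eind n v.
  by rewrite !eindE => -> /eqP/negbTE -> /eqP; rewrite eqxx oner_eq0.
case xi : (idx x) => [n|] xy; first by exists (eind n); apply: sep => // /esym.
case yi : (idx y) xy => [n|] // _; exists (eind n) => /esym.
by apply: sep => //; rewrite xi.
Qed.

Lemma fibrewise_separates : separates_points A.
Proof.
move=> x y xy; have [xiy|] := pselect (idx x = idx y); last exact: idx_separates.
by exists ecoord; rewrite !ecoordE => zxy; apply: xy; exact: disc_inj.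
Qed.

Lemma fibre_approx_lim (f : X -> Cx R) i :
  (forall e : R, 0 < e ->
    exists2 g, fibre_approx g i & forall x, Cabs (f x - g x) <= e) ->
  fibre_approx f i.
Proof.
move=> fl e e0; have e2 : 0 < e / 2 by rewrite divr_gt0.
have [g ga fg] := fl _ e2; have [p gp] := ga _ e2; exists p => x xi.
apply: le_trans (Cabs_distD (g x) _ _) _.
by have := fg x; have := gp x xi; lra.
Qed.

Lemma fibrewise_closed : closed [set f : cfun R X | f \in A].
Proof.
move=> f clf; apply/asboolP => i; apply: fibre_approx_lim => e e0.
have e0' : 0 < Creal e by rewrite -Creal0 ltr_Creal.
have : nbhs f [set g | `|f - g| < Creal e].
  by apply/nbhs_normP; exists (Creal e).
move=> /clf[g [/asboolP gA /= fg]]; exists g => // x.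
apply: le_trans (Cabs_le_fnorm (f - g) x) _.
by rewrite -ler_Creal -fnormE ltW.
Qed.

(** The points where |f| >= M + e form a compact set without points at height 0. Its heights form a
    closed set avoiding 0, hence stay above some 2^-N. A bound on the limit disc thus extends to
    almost all small discs. *)
Lemma tail_bound (f : cfun R X) (M e : R) : 0 < e ->
  (forall x, idx x = None -> Cabs (f x) <= M) ->
  exists N, forall x, (forall n, idx x = Some n -> (N <= n)%N) ->
    Cabs (f x) <= M + e.
Proof.
move=> e0 fM; pose C := [set x : X | M + e <= Cabs (f x)].
have cC : closed C.
  apply: (@closed_comp _ _ (fun x => Cabs (f x)) [set t | M + e <= t]).
    move=> x _; apply: continuous_comp; first exact: cfun_continuous.
    exact: Cabs_continuous.
  exact: closed_ge.
have : closed ((fun x : X => height R (idx x)) @` C).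
  apply: compact_closed; first exact: norm_hausdorff.
  apply: continuous_compact; last first.
    by apply: (subclosed_compact cC (@discs_compact R)).
  apply: continuous_subspaceT; exact: height_continuous.
move=> /closed_openC hC.
have : nbhs (0 : R) (~` ((fun x : X => height R (idx x)) @` C)).
  apply: open_nbhs_nbhs; split=> // -[x Cx].
  rewrite -[0]/(height R None) => /height_inj/fM; rewrite leNgt => /negP; apply.
  by apply: lt_le_trans Cx; rewrite ltrDl.
move=> /nbhs_normP[d /= d0 dC]; have [N NP] := half_exp_lt d0.
exists N => x xN; apply: contrapT => /negP; rewrite -ltNge => /ltW Cx.
apply: (dC (height R (idx x))); last by exists x.
rewrite /= sub0r normrN ger0_norm ?height_ge0//.
by case xi : (idx x) => [n|//]; apply: NP; exact: xN.
Qed.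

(** * Separability *)

Definition ratpoly (l : seq (rat * rat)) : {poly Cx R} :=
  Poly [seq Complex (ratr q.1) (ratr q.2) : Cx R | q <- l].

Lemma ratpoly_cons q l : ratpoly (q :: l) =
  ratpoly l * 'X + (Complex (ratr q.1) (ratr q.2) : Cx R)%:P.
Proof. by rewrite /ratpoly/= cons_poly_def. Qed.

Lemma ratpoly_dense (p : {poly Cx R}) (e : R) : 0 < e ->
  exists l, forall z, Cabs z <= 2 -> Cabs (p.[z] - (ratpoly l).[z]) <= e.
Proof.
elim/poly_ind: p e => [|p c IH] e e0.
  by exists [::] => z _; rewrite /ratpoly/= horner0 subrr Cabs0 ltW.
(* The error e / 4 of the quotient is multiplied by |z| <= 2, and each coordinate of the constant
   term adds at most e / 4. *)
have e4 : 0 < e / 4 by rewrite divr_gt0.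
have [l hl] := IH _ e4.
have [a] : exists q : rat, (ratr q : R) \in `]Cre c, Cre c + e / 4[.
  by apply: rat_in_itvoo; rewrite ltrDl.
have [b] : exists q : rat, (ratr q : R) \in `]Cim c, Cim c + e / 4[.
  by apply: rat_in_itvoo; rewrite ltrDl.
rewrite !in_itv/= => /andP[b1 b2] /andP[a1 a2].
exists ((a, b) :: l) => z z2; rewrite ratpoly_cons !hornerD !hornerM !hornerX !hornerC.
have -> : p.[z] * z + c - ((ratpoly l).[z] * z + (Complex (ratr a) (ratr b) : Cx R)) =
    (p.[z] - (ratpoly l).[z]) * z + (c - (Complex (ratr a) (ratr b) : Cx R)) by ring.
apply: le_trans (CabsD _ _) _; rewrite CabsM.
have h1 : Cabs (p.[z] - (ratpoly l).[z]) * Cabs z <= e / 4 * 2.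
  by apply: ler_pM; rewrite ?Cabs_ge0// hl.
have h2 : Cabs (c - (Complex (ratr a) (ratr b) : Cx R)) <= e / 2.
  rewrite CabsBC; apply: le_trans (Cabs_le_ReIm _) _; rewrite CreB CimB/=.
  by rewrite !gtr0_norm ?subr_gt0//; lra.
lra.
Qed.

Lemma fibre_approx_rat (f : X -> Cx R) i (e : R) : fibre_approx f i -> 0 < e ->
  exists l, forall x, idx x = i -> Cabs (f x - (ratpoly l).[zcoord x]) <= e.
Proof.
move=> fa e0; have e2 : 0 < e / 2 by rewrite divr_gt0.
have [p fp] := fa _ e2; have [l pl] := ratpoly_dense p e2.
exists l => x xi; apply: le_trans (Cabs_distD p.[zcoord x] _ _) _.
by have := fp x xi; have := pl _ (zcoord_le2 x); lra.
Qed.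

Definition rat_elt (c : seq (rat * rat) * seq (seq (rat * rat))) : elt A :=
  sval (piecewise_elt (ratpoly c.1) (map ratpoly c.2)).

(** A rational polynomial within e / 2 of a at height 0 is within e of a on all but finitely many
    small discs, by [tail_bound]; the remaining ones receive a polynomial each. Finitely many
    rational data therefore suffice. *)
Lemma rat_elt_dense (a : elt A) (e : R) : 0 < e ->
  exists c, forall x, Cabs (a x - rat_elt c x) <= e.
Proof.
move=> e0; have e2 : 0 < e / 2 by rewrite divr_gt0.
have [l al] := fibre_approx_rat (@eltA_approx a None) e2.
have [x xN|N NP] := @tail_bound (elt_val (a - epoly (ratpoly l))) (e / 2) _ e2.
  by rewrite -[X in Cabs X]/(a x - epoly (ratpoly l) x) epolyE al.
have /choice[F FP] n := fibre_approx_rat (@eltA_approx a (Some n)) e0.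
exists (l, mkseq F N) => x; rewrite /rat_elt (svalP (piecewise_elt _ _)) /piecewise/=.
have [xN|/existsNP[n /not_implyP[xn /negP]]] :=
    pselect (forall n, idx x = Some n -> (N <= n)%N); last first.
  rewrite -ltnNge => nN; rewrite xn (nth_map [::]) ?size_mkseq// nth_mkseq//.
  exact: FP.
have := NP _ xN; rewrite -[X in Cabs X]/(a x - epoly (ratpoly l) x) epolyE -splitr.
case xi : (idx x) => [n|] //.
by rewrite nth_default// size_map size_mkseq xN.
Qed.

Lemma fibrewise_separable : separable (elt A).
Proof.
exists (range rat_elt).
  exact: sub_countable (card_image_le _ _) (countableP _).
move=> W [a Wa] Wo.
have : nbhs a W by exact: open_nbhs_nbhs.
move=> /nbhs_normP[e /= e0 eW]; have [r r0 eE] := ge0_Creal (ltW e0).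
move: e0; rewrite eE -Creal0 ltr_Creal => {}r0.
have [c ac] := rat_elt_dense a (e := r / 2) ltac:(by rewrite divr_gt0).
exists (rat_elt c); split; last by exists c.
apply: eW; rewrite /= eE elt_normE fnormE ltr_Creal.
apply: (@le_lt_trans _ _ (r / 2)); last lra.
by apply: fnorm_le; first rewrite divr_ge0// ltW.
Qed.

End Algebra.

Lemma invf_continuous (K : numFieldType) (T : topologicalType) (f : T -> K) :
  continuous f -> (forall x, f x != 0) -> continuous (fun x => (f x)^-1).
Proof. by move=> cf f0 x; apply: cvgV; [exact: f0|exact: cf]. Qed.

(** * Characters *)

Section Characters.
Variable R : realType.
Notation X := (discs R).
Notation A := (fibrewise R).
Implicit Types a b : elt A.

(** Horner form of the truncated Neumann series of (l - a)^-1, the sum of a^k / l^(k+1) over k <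
    N. *)
Fixpoint geometric a (l : Cx R) N : elt A :=
  if N is N'.+1 then l^-1 *: (1 + a * geometric a l N') else 0.

Lemma geometric_error a l N x : l != 0 -> l - a x != 0 ->
  (l - a x)^-1 - geometric a l N x = (a x / l) ^+ N * (l - a x)^-1.
Proof.
move=> l0 la0; elim: N => [|N IH]; first by rewrite expr0 mul1r subr0.
rewrite -[geometric _ _ _ _]/(l^-1 * (1 + a x * geometric a l N x)).
rewrite exprS -mulrA -IH.
by field; rewrite l0 la0.
Qed.

(** The reciprocal of l - a is continuous because |l - a| >= |l| - fnorm a > 0, and it is the
    uniform limit of the Neumann sums, which lie in A. *)
Lemma resolvent_elt a (l : Cx R) : fnorm a < Cabs l ->
  exists b, forall x, b x * (l - a x) = 1.
Proof.
move=> al; have a0 := fnorm_ge0 (elt_val a).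
have l0 : 0 < Cabs l by apply: le_lt_trans al.
have l0' : l != 0 by rewrite -Cabs_eq0 gt_eqF.
pose r := Cabs l - fnorm (elt_val a).
have r0 : 0 < r by rewrite subr_gt0.
have rx x : r <= Cabs (l - a x).
  have := CabsD (l - a x) (a x); rewrite subrK => h.
  by have := Cabs_le_fnorm (elt_val a) x; rewrite /r; lra.
have lax x : l - a x != 0 by rewrite -Cabs_eq0 gt_eqF// (lt_le_trans r0).
have [||b bE] := @exists_elt R (fun x => (l - a x)^-1); last first.
- by exists b => x; rewrite bE mulVf.
- move=> i; apply: fibre_approx_lim => e e0.
  pose q := fnorm (elt_val a) / Cabs l.
  have q0 : 0 <= q by rewrite divr_ge0// ltW.
  have q1 : q < 1 by rewrite ltr_pdivrMr// mul1r.
  have : q ^+ n @[n --> \oo] --> 0 by apply: cvg_expr; rewrite ger0_norm.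
  move=> /cvgrPdist_lt/(_ (e * r)); rewrite mulr_gt0// => /(_ isT)[N _ /(_ N)].
  rewrite /= leqnn => /(_ isT); rewrite sub0r normrN ger0_norm ?exprn_ge0// => qN.
  exists (geometric a l N); first exact: eltA_approx.
  move=> x; rewrite geometric_error// !CabsM CabsX CabsM.
  have hV (z : Cx R) : z != 0 -> Cabs z^-1 = (Cabs z)^-1.
    move=> z0; apply: (@mulfI _ (Cabs z)); first by rewrite Cabs_eq0.
    by rewrite -CabsM mulfV// Cabs1 mulfV// Cabs_eq0.
  rewrite !hV// ler_pdivrMr; last by rewrite (lt_le_trans r0).
  apply: (@le_trans _ _ (q ^+ N)).
    rewrite lerXn2r ?nnegrE ?divr_ge0 ?Cabs_ge0//.
    by rewrite ler_wpM2r ?invr_ge0 ?Cabs_ge0// Cabs_le_fnorm.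
  by apply: (le_trans (ltW qN)); rewrite ler_wpM2l// ltW.
- apply: (@invf_continuous (Cx R) X) => //.
  have -> : (fun x : X => l - a x) = (l *: (1 : elt A) - a : elt A).
    by apply/funext => x; rewrite -[RHS]/(l * 1 - a x) mulr1.
  exact: cfun_continuous.
Qed.

Variable chi : elt A -> Cx R.
Hypothesis chi_char : is_character chi.

Let chi_scalar : scalar chi. Proof. by case: chi_char. Qed.
Let chiM a b : chi (a * b) = chi a * chi b. Proof. by case: chi_char. Qed.

Let chiD a b : chi (a + b) = chi a + chi b.
Proof. by rewrite -[a]scale1r chi_scalar mul1r scale1r. Qed.

Let chi0 : chi 0 = 0.
Proof. by apply: (@addrI _ (chi 0)); rewrite -chiD !addr0. Qed.

Let chiZ k a : chi (k *: a) = k * chi a.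
Proof. by rewrite -[k *: a]addr0 chi_scalar chi0 addr0. Qed.

Let chiB a b : chi (a - b) = chi a - chi b.
Proof. by rewrite -scaleN1r addrC chi_scalar mulN1r addrC. Qed.

Let chi1 : chi 1 = 1.
Proof.
have [_ _ [a /eqP a0]] := chi_char.
by apply: (mulIf a0); rewrite -chiM !mul1r.
Qed.

(** Otherwise chi(a) - a would be invertible in A although chi kills it. Continuity of characters is
    thus derived and not assumed. *)
Lemma character_contraction a : Cabs (chi a) <= fnorm a.
Proof.
rewrite leNgt; apply/negP => /resolvent_elt[b bE].
have : chi (b * (chi a *: (1 : elt A) - a)) = 1.
  rewrite -chi1; congr chi; apply: elt_eqP => x.
  by rewrite -[LHS]/(b x * (chi a * 1 - a x)) mulr1 bE.
rewrite chiM chiB chiZ chi1 mulr1 subrr mulr0 => /esym/eqP.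
by rewrite oner_eq0.
Qed.

Lemma etailS N : etail R N.+1 = etail R N - eind R N.
Proof.
apply: elt_eqP => x; rewrite -[RHS]/(etail R N x - eind R N x) !etailE eindE.
case: (idx x) => [n|]; last by rewrite subr0.
rewrite -[Some n == _]/(n == N) eq_sym.
by case: (ltngtP N n) => _; rewrite ?subrr ?subr0.
Qed.

Lemma character_etail N : (forall n, chi (eind R n) = 0) -> chi (etail R N) = 1.
Proof.
move=> chi_e; elim: N => [|N IH].
  rewrite -chi1; congr chi; apply: elt_eqP => x.
  by rewrite etailE; case: (idx x).
by rewrite etailS chiB IH chi_e subr0.
Qed.

(** If chi does not kill some idempotent [eind n], it takes the value 1 there and chi(a) = chi(a *
    eind n) sees only disc n. If it kills them all, chi(a) = chi(a * etail N) for every N, and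
    [tail_bound] leaves only the disc at height 0. *)
Lemma character_fibre : exists i, forall a (M : R), 0 <= M ->
  (forall x, idx x = i -> Cabs (a x) <= M) -> Cabs (chi a) <= M.
Proof.
have [[n chi_n]|chi_e] := pselect (exists n, chi (eind R n) <> 0).
  exists (Some n) => a M M0 aM.
  have en : chi (eind R n) = 1.
    move/eqP in chi_n; apply: (mulfI chi_n); rewrite mulr1 -chiM; congr chi.
    apply: elt_eqP => x; rewrite -[LHS]/(eind R n x * eind R n x) eindE.
    by case: eqP; rewrite ?mulr1 ?mulr0.
  have -> : chi a = chi (a * eind R n) by rewrite chiM en mulr1.
  apply: le_trans (character_contraction _) _; apply: fnorm_le => // x.
  rewrite -[X in Cabs X]/(a x * eind R n x) eindE.
  by case: eqP => [/aM|_]; rewrite ?mulr1// mulr0 Cabs0.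
have {}chi_e n : chi (eind R n) = 0.
  by apply: contrapT => h; apply: chi_e; exists n.
exists None => a M M0 aM; apply/ler_addgt0Pr => e e0.
have [N NP] := tail_bound e0 aM.
have -> : chi a = chi (a * etail R N) by rewrite chiM character_etail// mulr1.
apply: le_trans (character_contraction _) _; apply: fnorm_le => [|x].
  by rewrite addr_ge0// ltW.
rewrite -[X in Cabs X]/(a x * etail R N x) etailE.
case xi : (idx x) => [n|]; last first.
  by rewrite mulr1; apply: NP => n; rewrite xi.
case: leqP => nN; last by rewrite mulr0 Cabs0 addr_ge0// ltW.
by rewrite mulr1; apply: NP => m; rewrite xi => -[<-].
Qed.

Lemma character_epoly p : chi (epoly p) = p.[chi (ecoord R)].
Proof.
elim/poly_ind: p => [|p c IH].
  rewrite horner0 -chi0; congr chi; apply: elt_eqP => x.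
  by rewrite epolyE horner0.
have -> : epoly (p * 'X + c%:P) = epoly p * ecoord R + c *: (1 : elt A).
  apply: elt_eqP => x.
  rewrite -[RHS]/(epoly p x * ecoord R x + c * 1) !epolyE ecoordE mulr1.
  by rewrite hornerD hornerM hornerX hornerC.
by rewrite chiD chiM chiZ chi1 mulr1 IH hornerD hornerM hornerX hornerC.
Qed.

(** Applying the bound on disc i to z minus its centre places chi(z) in that disc. There chi agrees
    with evaluation on polynomials, which are dense on the disc. *)
Lemma character_evaluation : exists x, forall a, chi a = a x.
Proof.
have [i chi_i] := character_fibre.
have chi_disc : Cabs (chi (ecoord R) - disc_center R i) <= disc_radius R i.
  have -> : chi (ecoord R) - disc_center R i = chi (ecoord R - disc_center R i *: (1 : elt A)).
    by rewrite chiB chiZ chi1 mulr1.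
  apply: chi_i => [|x xi]; first exact/ltW/disc_radius_gt0.
  rewrite -[X in Cabs X]/(ecoord R x - disc_center R i * 1) ecoordE mulr1 -xi.
  exact: discP.
exists (disc_at chi_disc) => a; apply/eqP; rewrite -subr_eq0; apply/eqP.
apply: Cabs_le_eps => e e0; have e2 : 0 < e / 2 by rewrite divr_gt0.
have [p ap] := @eltA_approx _ a i _ e2.
apply: le_trans (Cabs_distD (chi (epoly p)) _ _) _; rewrite [leRHS]splitr lerD//.
  rewrite -chiB; apply: chi_i => [|x xi]; first exact: ltW.
  by rewrite -[X in Cabs X]/(a x - epoly p x) epolyE ap.
by rewrite character_epoly CabsBC; exact: ap.
Qed.

End Characters.

(** * The essential set *)

Section Essential.
Variable R : realType.
Notation X := (discs R).
Notation A := (fibrewise R).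

(** A point of a small disc is moved slightly towards the centre; a point at height 0 is replaced by
    the centre of a small disc of large index. Interior points are sought so that a ball around them
    fits inside the disc. *)
Lemma interior_points_dense (V : set X) : open V -> V !=set0 ->
  exists x n, [/\ V x, idx x = Some n & Cabs (zcoord x - node R n) < disc_radius R (Some n)].
Proof.
move=> Vo [x Vx]; have : nbhs x V by exact: open_nbhs_nbhs.
move=> /nbhs_discs[d d0 dV].
case xi : (idx x) => [n|].
  have xn : Cabs (zcoord x - node R n) <= disc_radius R (Some n).
    by have := discP x; rewrite xi.
  have r1 : disc_radius R (Some n) <= 1 by exact: (height_le1 R (Some n)).
  have r0 := disc_radius_gt0 R (Some n).
  pose t : R := Num.min 2^-1 (d / 2).
  have t0 : 0 < t by rewrite lt_min invr_gt0 ltr0n divr_gt0.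
  have t1 : t <= 2^-1 by rewrite ge_min lexx.
  have t2 : t <= d / 2 by rewrite ge_min lexx orbT.
  pose z := zcoord x - Creal t * (zcoord x - node R n).
  have zn : Cabs (z - node R n) < disc_radius R (Some n).
    have -> : z - node R n = Creal (1 - t) * (zcoord x - node R n).
      rewrite /z [Creal (1 - t)](_ : _ = 1 - Creal t); first by ring.
      by rewrite /Creal rmorphB rmorph1.
    rewrite CabsM Cabs_Creal ger0_norm; last lra.
    apply: (@le_lt_trans _ _ ((1 - t) * disc_radius R (Some n))); last by nra.
    by rewrite ler_wpM2l//; lra.
  exists (disc_at (ltW zn : Cabs (z - disc_center R (Some n)) <= _)), n; split=> //.
  apply: dV; first by rewrite xi subrr normr0.
  rewrite -[zcoord (disc_at _)]/z /z addrAC subrr sub0r CabsN CabsM Cabs_Creal.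
  rewrite gtr0_norm//; apply: (@le_lt_trans _ _ (t * 1)); last by lra.
  by rewrite ler_wpM2l ?(ltW t0)//; apply: le_trans xn r1.
have x1 : Cabs (zcoord x) <= 1 by have := discP x; rewrite xi subr0.
have [N NP] := half_exp_lt d0; have [n Nn nx] := node_near N x1 d0.
have r0 := disc_radius_gt0 R (Some n).
have h : Cabs (node R n - disc_center R (Some n)) <= disc_radius R (Some n).
  by rewrite subrr Cabs0 ltW.
exists (disc_at h), n; split => //; last by rewrite subrr Cabs0.
apply: dV; last exact: nx.
by rewrite xi subr0 ger0_norm ?height_ge0//; exact: NP.
Qed.

Definition bump (c : Cx R) (r : R) (z : Cx R) : Cx R :=
  Creal (Num.max 0 (r - Cabs (z - c))).

Lemma bump_continuous c r : continuous (bump c r).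
Proof.
move=> z; apply/(@cvg_CabsP _ _ (nbhs z) (nbhs_filter z)) => e e0.
apply: (@filterS _ (nbhs z) (nbhs_filter z) _ _ _ (nbhs_Cabs z e0)) => w /=.
apply: le_lt_trans; rewrite /bump /Creal -rmorphB -/(Creal _) Cabs_Creal.
have h1 := Cabs_distD w z c; have h2 := Cabs_distD z w c; rewrite (CabsBC z w) in h1.
rewrite ler_norml; apply/andP; split.
  by case: (leP 0 (r - Cabs (z - c))); case: (leP 0 (r - Cabs (w - c))); lra.
by case: (leP 0 (r - Cabs (z - c))); case: (leP 0 (r - Cabs (w - c))); lra.
Qed.

(* A bump is constant equal to r/2 on the circle of radius r/2 about c and equal to r at c, which
   the maximum principle forbids to uniform limits of polynomials. *)
Lemma bump_not_approx n (c : Cx R) (r : R) (f : X -> Cx R) : 0 < r ->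
  Cabs (c - node R n) + r <= disc_radius R (Some n) ->
  (forall x, idx x = Some n -> f x = bump c r (zcoord x)) ->
  ~ fibre_approx f (Some n).
Proof.
move=> r0 cr fE /(_ (r / 8)); rewrite divr_gt0// => /(_ isT)[p fp].
have {fp}bp z : Cabs (z - c) <= r -> Cabs (bump c r z - p.[z]) <= r / 8.
  move=> zc; have h : Cabs (z - disc_center R (Some n)) <= disc_radius R (Some n).
    by apply: le_trans (Cabs_distD c _ _) _; move: cr zc => /=; lra.
  by have := fp (disc_at h) erefl; rewrite fE.
have h1 : Cabs (p.[c] - Creal (r / 2)) <= r / 8.
  rewrite -[Creal _](hornerC _ c) -hornerN -hornerD.
  apply: (@max_principle _ _ _ (r / 2)); first by rewrite divr_gt0.
  move=> z zc; rewrite hornerD hornerN hornerC CabsBC.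
  suff <- : bump c r z = Creal (r / 2) by apply: bp; lra.
  by rewrite /bump zc; congr Creal; rewrite max_r; lra.
have := bp c; rewrite subrr Cabs0 => /(_ (ltW r0)).
rewrite /bump subrr Cabs0 subr0 max_r ?(ltW r0)// => h2.
have := le_trans (Cabs_distD p.[c] (Creal r) (Creal (r / 2))) (lerD h2 h1).
rewrite /Creal -rmorphB -/(Creal _) Cabs_Creal.
have -> : r - r / 2 = r / 2 by lra.
by rewrite gtr0_norm ?divr_gt0//; lra.
Qed.

(** If a closed F misses a point, its complement contains an interior point of some small disc; a
    bump there vanishes on F but is not a limit of polynomials on that disc. *)
Lemma fibrewise_essential : essential A.
Proof.
split; first split.
- exact: closedT.
- move=> f f0; apply/asboolP => i; apply: (@fibre_approx_poly _ _ _ 0) => x _.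
  by rewrite horner0 f0.
move=> F [Fc FP] x _; apply: contrapT => Fx.
have FCo : open (~` F) by exact: closed_openC.
have [|y [n [Fy yn yr]]] := interior_points_dense FCo; first by exists x.
have : nbhs y (~` F) by exact: open_nbhs_nbhs.
move=> /nbhs_discs[d d0 dF].
pose r := Num.min d (disc_radius R (Some n) - Cabs (zcoord y - node R n)).
have r0 : 0 < r by rewrite lt_min d0 subr_gt0.
have rd : r <= d by rewrite ge_min lexx.
have rr : Cabs (zcoord y - node R n) + r <= disc_radius R (Some n).
  by rewrite addrC -lerBrDr ge_min lexx orbT.
have cb : (fun u : X => bump (zcoord y) r (zcoord u)) \in continuous_pred (R := R) (X := X).
  apply/asboolP => u; apply: (@continuous_comp X _ _ (@zcoord R) (bump (zcoord y) r)).
    exact: zcoord_continuous.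
  exact: bump_continuous.
(* The bump depends on the coordinate alone, so the indicator removes it from other discs over the
   same coordinates, which may meet F. *)
pose g : cfun R X := elt_val (eind R n) * CFun cb.
have gE u : g u = (idx u == Some n)%:R * bump (zcoord y) r (zcoord u).
  by rewrite -eindE.
have /FP/asboolP/(_ (Some n)) : forall u, F u -> g u = 0.
  move=> u Fu; rewrite gE; case: eqP => un; last by rewrite mul0r.
  rewrite mul1r /bump; have -> : Num.max 0 (r - Cabs (zcoord u - zcoord y)) = 0.
    apply/max_l; rewrite subr_le0; apply: le_trans rd _; rewrite leNgt.
    by apply/negP => h; apply: dF Fu; rewrite // un yn subrr normr0.
  exact: Creal0.
apply: bump_not_approx r0 rr _ => u un.
by rewrite gE un eqxx mul1r.
Qed.

End Essential.

(** * The point derivation *)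

Section PointDerivation.
Variable R : realType.
Notation X := (discs R).
Notation A := (fibrewise R).
Implicit Types (a b : elt A) (p q : {poly Cx R}).

Definition base_approx (f : X -> Cx R) p (M : R) :=
  forall x, idx x = None -> Cabs (f x - p.[zcoord x]) <= M.

Lemma base_approx_coef1 f p q (M N : R) : base_approx f p M -> base_approx f q N ->
  Cabs (p`_1 - q`_1) <= 2 * (M + N).
Proof.
move=> fp fq; rewrite -coefB; apply: coef1_bound => z z1.
have h : Cabs (z - disc_center R None) <= disc_radius R None by rewrite subr0.
have hp := fp (disc_at h) erefl; have hq := fq (disc_at h) erefl.
rewrite hornerD hornerN; apply: le_trans (Cabs_distD (f (disc_at h)) _ _) _.
by rewrite CabsBC lerD.
Qed.

(* By the Cauchy estimate the intervals [u p`_1 - 2 M, u p`_1 + 2 M] meet pairwise,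
   so the supremum of their left ends is in all of them. *)
Lemma real_derivative_exists f (u : Cx R -> R) :
  (forall z w, u z - u w <= Cabs (z - w)) ->
  exists c : R, forall p M, base_approx f p M -> `|c - u p`_1| <= 2 * M.
Proof.
move=> u_lip.
pose S := [set s : R | exists p M, base_approx f p M /\ s = u p`_1 - 2 * M].
have S_le q N : base_approx f q N -> ubound S (u q`_1 + 2 * N).
  move=> fq _ [p [M [fp ->]]].
  have := base_approx_coef1 fp fq; have := u_lip p`_1 q`_1; lra.
exists (sup S) => p M fp; have Sp : S (u p`_1 - 2 * M) by exists p, M.
have h1 : sup S <= u p`_1 + 2 * M.
  by apply: ge_sup; [exists (u p`_1 - 2 * M)|exact: S_le].
have h2 : u p`_1 - 2 * M <= sup S.
  by apply: ub_le_sup => //; exists (u p`_1 + 2 * M); exact: S_le.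
by rewrite ler_norml; apply/andP; split; lra.
Qed.

Lemma derivative_exists f : exists c : Cx R, forall p M,
  base_approx f p M -> Cabs (c - p`_1) <= 4 * M.
Proof.
have [|s sP] := @real_derivative_exists f (@Cre R).
  by move=> z w; rewrite -CreB; apply: le_trans (ler_norm _) (Cre_le_Cabs _).
have [|t tP] := @real_derivative_exists f (@Cim R).
  by move=> z w; rewrite -CimB; apply: le_trans (ler_norm _) (Cim_le_Cabs _).
exists (Complex s t) => p M fp; apply: le_trans (Cabs_le_ReIm _) _.
by rewrite CreB CimB/=; have := sP _ _ fp; have := tP _ _ fp; lra.
Qed.

(** The derivative at the origin of the disc at height 0, known only through its closeness to the
    linear coefficients of approximating polynomials. *)
Definition der (f : X -> Cx R) : Cx R := sval (cid (derivative_exists f)).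

Lemma der_approx f p M : base_approx f p M -> Cabs (der f - p`_1) <= 4 * M.
Proof. exact: (svalP (cid (derivative_exists f))). Qed.

(** The rules for [der] reduce to identities between coefficients: one polynomial has to approximate
    f while its linear coefficient approximates c. The two errors add up to 4 K e + K e. *)
Lemma der_eq f (c : Cx R) (K : R) :
  (forall e, 0 < e -> e <= 1 ->
    exists p, base_approx f p (K * e) /\ Cabs (c - p`_1) <= K * e) ->
  der f = c.
Proof.
move=> h; apply/eqP; rewrite -subr_eq0; apply/eqP.
apply: (@Cabs_le_Meps _ _ (5 * K)) => e e0 e1; have [p [/der_approx fp cp]] := h e e0 e1.
by apply: le_trans (Cabs_distD p`_1 _ _) _; rewrite (CabsBC p`_1); lra.
Qed.

Lemma der_poly f p : base_approx f p 0 -> der f = p`_1.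
Proof.
move=> fp; apply: (@der_eq _ _ 0) => e _ _; exists p.
by rewrite mul0r subrr Cabs0.
Qed.

Lemma der_linear (k : Cx R) a b : der (k *: a + b : elt A) = k * der a + der b.
Proof.
apply: (@der_eq _ _ (4 * (Cabs k + 1))) => e e0 _.
have [p ap] := @eltA_approx _ a None _ e0; have [q bq] := @eltA_approx _ b None _ e0.
have k0 := Cabs_ge0 k.
exists (k *: p + q); split=> [x xN|].
  rewrite -[(k *: a + b : elt A) x]/(k * a x + b x) hornerD hornerZ.
  have -> : k * a x + b x - (k * p.[zcoord x] + q.[zcoord x]) =
    k * (a x - p.[zcoord x]) + (b x - q.[zcoord x]) by ring.
  apply: le_trans (CabsD _ _) _; rewrite CabsM.
  have := ler_wpM2l k0 (ap x xN); have := bq x xN; nra.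
rewrite coefD coefZ.
have -> : k * der a + der b - (k * p`_1 + q`_1) =
  k * (der a - p`_1) + (der b - q`_1) by ring.
apply: le_trans (CabsD _ _) _; rewrite CabsM.
have := ler_wpM2l k0 (der_approx ap); have := der_approx bq; lra.
Qed.

Lemma der_bound a : Cabs (der a) <= 4 * fnorm (elt_val a).
Proof.
have := @der_approx a 0 (fnorm (elt_val a)); rewrite coef0 subr0; apply => x _.
by rewrite horner0 subr0 Cabs_le_fnorm.
Qed.

Definition origin : X :=
  @disc_at R None 0 ltac:(by rewrite subr0 Cabs0 ltW// disc_radius_gt0).

Lemma Cabs_mulB_le (v w p q : Cx R) (s t B : R) :
  Cabs (v - p) <= s -> Cabs (w - q) <= t -> Cabs w + t <= B ->
  Cabs (v * w - p * q) <= Cabs v * t + B * s.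
Proof.
move=> vp wq wB; apply: le_trans (Cabs_mulB _ _ _ _) _.
apply: lerD; first by rewrite ler_wpM2l ?Cabs_ge0.
apply: ler_pM; rewrite ?addr_ge0 ?Cabs_ge0//.
by apply: le_trans wB; rewrite lerD2l.
Qed.

Lemma der_mul a b : der (a * b : elt A) = der a * b origin + a origin * der b.
Proof.
have [a0 b0] := (fnorm_ge0 (elt_val a), fnorm_ge0 (elt_val b)).
have [da0 db0] := (Cabs_ge0 (der a), Cabs_ge0 (der b)).
(* The values need fnorm a + fnorm b + 1. The linear coefficients need 4 (fnorm a + fnorm b + 2) +
   |der a| + |der b|, the 4 coming from [der_approx]. K dominates both. *)
pose K := 5 * (fnorm (elt_val a) + fnorm (elt_val b) + 2) + Cabs (der a) + Cabs (der b).
apply: (@der_eq _ _ K) => e e0 e1.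
have [p ap] := @eltA_approx _ a None _ e0; have [q bq] := @eltA_approx _ b None _ e0.
exists (p * q); split=> [x xN|].
  rewrite -[(a * b : elt A) x]/(a x * b x) hornerM.
  apply: le_trans (Cabs_mulB _ _ _ _) _.
  have := Cabs_le_fnorm (elt_val a) x; have := Cabs_le_fnorm (elt_val b) x.
  have := ap x xN; have := bq x xN; have := Cabs_ge0 (b x - q.[zcoord x]).
  have := Cabs_ge0 (a x - p.[zcoord x]); have := Cabs_ge0 (a x); have := Cabs_ge0 (b x).
  rewrite /K; nra.
have -> : (p * q)`_1 = p`_1 * q`_0 + p`_0 * q`_1.
  by rewrite coefM big_ord_recl big_ord1/= addrC.
have ap0 : Cabs (a origin - p`_0) <= e by rewrite -horner_coef0; exact: (ap origin).
have bq0 : Cabs (b origin - q`_0) <= e by rewrite -horner_coef0; exact: (bq origin).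
have -> : der a * b origin + a origin * der b - (p`_1 * q`_0 + p`_0 * q`_1) =
  (der a * b origin - p`_1 * q`_0) + (a origin * der b - p`_0 * q`_1) by ring.
apply: le_trans (CabsD _ _) _.
have b1 : Cabs (b origin) + e <= fnorm (elt_val b) + 1.
  by rewrite lerD// Cabs_le_fnorm.
have a1 : Cabs (a origin) + e <= fnorm (elt_val a) + 1.
  by rewrite lerD// Cabs_le_fnorm.
have h1 := Cabs_mulB_le (der_approx ap) bq0 b1.
have h2 := Cabs_mulB_le (der_approx bq) ap0 a1.
rewrite (mulrC (a origin)) (mulrC p`_0); move: h1 h2; rewrite /K => h1 h2.
apply: le_trans (lerD h1 h2) _; nra.
Qed.

Lemma lipschitz_continuous_elt (phi : elt A -> Cx R) (K : R) :
  (forall a b, Cabs (phi a - phi b) <= K * fnorm (elt_val (a - b))) ->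
  continuous phi.
Proof.
move=> lip a; apply/(@cvg_CabsP _ _ (nbhs a) (nbhs_filter a)) => e e0.
have K1 : 0 < `|K| + 1 by rewrite ltr_wpDl.
have d0 : 0 < e / (`|K| + 1) by rewrite divr_gt0.
apply/(@nbhs_normP (Cx R) (elt A)); exists (Creal (e / (`|K| + 1))).
  by rewrite /= -Creal0 ltr_Creal.
move=> b /=; rewrite elt_normE fnormE ltr_Creal ltr_pdivlMr// => ab.
rewrite CabsBC; apply: le_lt_trans (lip a b) _; apply: le_lt_trans ab.
rewrite mulrC ler_wpM2l ?fnorm_ge0//; have := ler_norm K; lra.
Qed.

Lemma der_continuous : continuous (fun a : elt A => der a).
Proof.
apply: (@lipschitz_continuous_elt _ 4) => a b.
have -> : der a - der b = der (a - b : elt A).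
  rewrite [a - b in RHS](_ : _ = -1 *: b + a); last by rewrite scaleN1r addrC.
  by rewrite der_linear mulN1r addrC.
exact: der_bound.
Qed.

Lemma eval_dual_pred (x : X) : (fun a : elt A => a x) \in dual_pred (V := elt A).
Proof.
apply/asboolP; split=> [k a b //|].
apply: (@lipschitz_continuous_elt _ 1) => a b.
by rewrite mul1r; exact: (Cabs_le_fnorm (elt_val (a - b)) x).
Qed.

Definition eval_dual (x : X) : dual (elt A) := Dual (eval_dual_pred x).

Definition point_derivation (a : elt A) : dual (elt A) := der a *: eval_dual origin.

(** Either action of a on evaluation at the origin multiplies it by a(0), so the derivation identity
    is the product rule [der_mul] at that same point. *)
Lemma point_derivation_derivation : derivation point_derivation.
Proof.
split=> [k a b|a b]; apply: dual_eqP => c.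
  rewrite -[LHS]/(der (k *: a + b : elt A) * c origin).
  rewrite -[RHS]/(k * (der a * c origin) + der b * c origin).
  by rewrite der_linear mulrDl mulrA.
rewrite -[LHS]/(der (a * b : elt A) * c origin).
rewrite -[RHS]/(der a * (b origin * c origin) + der b * (c origin * a origin)).
by rewrite der_mul; ring.
Qed.

Lemma point_derivation_continuous : continuous point_derivation.
Proof.
move=> a; apply: (@continuous_comp (elt A) (Cx R) (dual (elt A))
  (fun a : elt A => der a) (fun k => k *: eval_dual origin)).
  exact: der_continuous.
exact: scalel_continuous.
Qed.

Definition enodal : elt A := sval (nodal_elt R).

Lemma enodalE x : enodal x = nodal x.
Proof. exact: (svalP (nodal_elt R)). Qed.

Lemma enodal_lc : lc A enodal.
Proof.
exists [set x : X | idx x != None]; split.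
- rewrite openE => x /=; case xi : (idx x) => [n|//] _.
  by apply: filterS (near_idx xi) => y /= ->.
- move=> V V0 Vo; have [x [n [Vx xn _]]] := interior_points_dense Vo V0.
  by exists x; split=> //=; rewrite xn.
- move=> x /=; case xi : (idx x) => [n|//] _.
  by apply: filterS (near_idx xi) => y yn; rewrite !enodalE /nodal yn xi.
Qed.

Lemma point_derivation_enodal : point_derivation enodal <> 0.
Proof.
have d1 : der enodal = 1.
  rewrite (@der_poly _ 'X) ?coefX// => x xN.
  by rewrite enodalE /nodal xN hornerX subrr Cabs0.
(* The functional is tested on the constant 1, where evaluation at the origin gives 1. *)
move=> /(congr1 (fun phi : dual (elt A) => phi 1)).
rewrite -[LHS]/(der enodal * 1) d1 mulr1 => /eqP.
by rewrite -[X in _ == X]/(0 : Cx R) oner_eq0.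
Qed.

End PointDerivation.

Theorem mainTheorem3 (R : realType) :
  exists (X : compactHausdorffType) (A : subalgebra R X)
    (D : elt A -> dual (elt A)),
    [/\ uniform_algebra A, separable (elt A), essential A,
        derivation D /\ continuous D &
        exists2 f : elt A, lc A f & D f <> 0].
Proof.
exists (discs R), (fibrewise R), (@point_derivation R); split.
- split; [exact: fibrewise_closed|exact: fibrewise_separates|].
  exact: character_evaluation.
- exact: fibrewise_separable.
- exact: fibrewise_essential.
- split; [exact: point_derivation_derivation|exact: point_derivation_continuous].
- exists (enodal R); [exact: enodal_lc|exact: point_derivation_enodal].
Qed.
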